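(* Let $\mathbb{P}_{\mathbf{\Sigma}}$ be the two-dimensional toric Deligne–Mumford stack associated to a complete stacky fan $\mathbf{\Sigma}=(\Sigma,\{v_i\}_{i=1}^n)$ in $N\cong\mathbb{Z}^2$, and let $\{v_{p_i},v_{q_i}\}_{i=1}^{l}$ be all the collinear pairs among $v_1,\dots,v_n$. Then there are $l$ lines $\ell_1,\dots,\ell_l$ through the origin $O$ of $V=\mathrm{Pic}_{\mathbb{R}}(\mathbb{P}_{\mathbf{\Sigma}})$ and a number $R_0>0$ such that the following holds: if $T_i$ is a tube with center line $\ell_i$ and radius at least $R_0$ ($i=1,\dots,l$) and $B$ is a ball with center $O$ and radius at least $R_0$, then any line bundle on $\mathbb{P}_{\mathbf{\Sigma}}$ whose class in $V$ lies outside of $B\cup\left(\bigcup_{i=1}^{l}T_i\right)$ is not $\mathrm{H}$-trivial.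
   Context: Setting: $N\cong\mathbb{Z}^2$ is a lattice, $N^*=\mathrm{Hom}(N,\mathbb{Z})$, and $\Sigma$ is a complete simplicial fan in $N$ with $n$ one-dimensional cones. A stacky fan $\mathbf{\Sigma}=(\Sigma,\{v_i\}_{i=1}^n)$ consists of $\Sigma$ together with a choice of a nonzero lattice point $v_i\in N$ (not necessarily primitive) in each one-dimensional cone of $\Sigma$. Two vectors $v_i,v_j$ with $i\neq j$ are collinear if they lie on a common line through the origin; since they span distinct rays this means $v_j=-c\,v_i$ for some $c>0$. The stack: let $G=\{(\zeta_1,\dots,\zeta_n)\in(\mathbb{C}^* )^n \mid \prod_{i=1}^n\zeta_i^{w\cdot v_i}=1\text{ for all } w\in N^*\}$, and let $U\subset\mathbb{C}^n$ be the open set of points $(x_1,\dots,x_n)$ such that some cone of $\Sigma$ contains all $v_i$ with $x_i=0$. $G$ acts on $U$ coordinatewise, and $\mathbb{P}_{\mathbf{\Sigma}}=[U/G]$. Line bundles: for $(r_1,\dots,r_n)\in\mathbb{Z}^n$, $\mathcal{O}(\sum_i r_iE_i)$ is the line bundle on $\mathbb{P}_{\mathbf{\Sigma}}$ given by the trivial line bundle $\mathbb{C}\times U\to U$ with $G$-linearization $((\zeta_i),t,(x_i))\mapsto(t\prod_i\zeta_i^{r_i},(\zeta_ix_i))$. All line bundles arise this way, and $\mathrm{Pic}(\mathbb{P}_{\mathbf{\Sigma}})$ is the quotient of $\mathbb{Z}^n$ (basis $E_1,\dots,E_n$) by the subgroup of elements $\sum_i (w\cdot v_i)E_i$, $w\in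 N^*$. A line bundle $\mathcal{L}$ is called $\mathrm{H}$-trivial if $\mathrm{H}^j(\mathbb{P}_{\mathbf{\Sigma}},\mathcal{L})=0$ for all $j\ge 0$. $V=\mathrm{Pic}_{\mathbb{R}}(\mathbb{P}_{\mathbf{\Sigma}})=\mathrm{Pic}(\mathbb{P}_{\mathbf{\Sigma}})\otimes\mathbb{R}$ is a finite-dimensional real vector space, on which a Euclidean metric is fixed. A tube with center line $\ell$ and radius $\beta$ is the set of points of $V$ at distance at most $\beta$ from $\ell$. A line bundle is said to lie outside a subset of $V$ if its image in $V$ does. *)

(* Defs.v *)
From HB Require Import structures.
From mathcomp Require Import all_boot all_order all_algebra.
From mathcomp Require Import sesquilinear.
From mathcomp Require Import complex.
From mathcomp Require Import boolp classical_sets reals.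
From mathcomp Require Import monalg.

Set Implicit Arguments.
Unset Strict Implicit.
Unset Printing Implicit Defensive.

Import Order.TTheory GRing.Theory Num.Theory.

Local Open Scope ring_scope.

(* N is the lattice of integer row vectors 'rV[int]_2 and N^* the lattice of  *)
(* integer column vectors; the same pairing is used after extension of        *)
(* scalars from the integers to R.                                            *)
Definition pairing (K : pzRingType) (w : 'cV[K]_2) (x : 'rV[K]_2) : K :=
  (x *m w) 0 0.

Definition realify (R : realType) (m : nat) (x : 'rV[int]_m) : 'rV[R]_m :=
  map_mx intr x.

Definition cone (R : realType) (n : nat) (v : 'I_n -> 'rV[int]_2)
    (sigma : {set 'I_n}) : set 'rV[R]_2 :=
  [set x | exists c : 'I_n -> R,
     (forall i, 0 <= c i) /\
     x = \sum_(i in sigma) c i *: realify R (v i)]%classic.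

(* A cone of a simplicial fan is recorded as the set of indices of its rays,  *)
(* the i-th ray being spanned by v i, so Sigma is a set of subsets of 'I_n    *)
(* and the faces of sigma are its subsets. As distinct one-element subsets    *)
(* give distinct rays, the common face of two cones has to be the cone on     *)
(* their common rays.                                                         *)
Record complete_stacky_fan (R : realType) (n : nat)
    (Sigma : {set {set 'I_n}}) (v : 'I_n -> 'rV[int]_2) : Prop := {
  fan_generator_neq0 : forall i, v i != 0;
  fan_ray : forall i, [set i] \in Sigma;
  fan_face : forall sigma tau : {set 'I_n},
    sigma \in Sigma -> tau \subset sigma -> tau \in Sigma;
  fan_simplicial : forall sigma : {set 'I_n},
    sigma \in Sigma -> free [seq realify R (v i) | i <- enum sigma];
  fan_inter : forall sigma tau : {set 'I_n},
    sigma \in Sigma -> tau \in Sigma ->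
    (cone (R := R) v sigma `&` cone v tau = cone v (sigma :&: tau))%classic;
  fan_complete : forall x : 'rV[R]_2,
    exists2 sigma, sigma \in Sigma & cone v sigma x
}.

Definition collinear (R : realType) (x y : 'rV[int]_2) : Prop :=
  exists L : {vspace 'rV[R]_2},
    [/\ \dim L = 1%N, realify R x \in L & realify R y \in L].

Definition collinear_pairs (R : realType) (n : nat)
    (v : 'I_n -> 'rV[int]_2) : {set 'I_n * 'I_n} :=
  [set p : 'I_n * 'I_n |
     (p.1 < p.2)%N && `[< collinear R (v p.1) (v p.2) >]].

(* U is the union over sigma in Sigma of the affine open sets                 *)
(*   U_sigma = {x | x_i = 0 only if i \in sigma},                             *)
(* and U_sigma :&: U_tau = U_(sigma :&: tau). The stack [U/G] is thus covered *)
(* by the open substacks [U_sigma/G]. These and their intersections are       *)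
(* quotients of affine varieties by a diagonalizable group, hence have no     *)
(* higher coherent cohomology, and the separated stack [U/G] has affine       *)
(* diagonal. So the cohomology of a line bundle on [U/G] is that of its Cech  *)
(* complex for this covering.                                                 *)

Definition character (R : realType) (n : nat) (zeta : 'I_n -> R[i])
    (a : 'rV[int]_n) : R[i] :=
  \prod_i zeta i ^ a 0 i.

Definition in_G (R : realType) (n : nat) (v : 'I_n -> 'rV[int]_2)
    (zeta : 'I_n -> R[i]) : Prop :=
  (forall i, zeta i != 0) /\
  forall w : 'cV[int]_2, \prod_i zeta i ^ pairing w (v i) = 1.

(* f@_a is the coefficient of x^a = prod_i x_i ^ (a 0 i) in f.                *)
Definition laurent (R : realType) (n : nat) := {malg R[i]['rV[int]_n]}.

(* The coordinate ring of U_sigma is C[x_1, .., x_n] with the x_i for         *)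
(* i \notin sigma inverted.                                                   *)
Definition regular_on (R : realType) (n : nat) (sigma : {set 'I_n})
    (f : laurent R n) : Prop :=
  forall a : 'rV[int]_n, f@_a != 0 -> forall i, i \in sigma -> 0 <= a 0 i.

(* For the linearization (zeta, t, x) |-> (t zeta^r, zeta x), the section     *)
(* x |-> (f x, x) descends to the quotient iff f (zeta x) = zeta^r f x; the   *)
(* coefficient of x^a in f (zeta x) is zeta^a f@_a.                           *)
Definition semi_invariant (R : realType) (n : nat) (v : 'I_n -> 'rV[int]_2)
    (r : 'rV[int]_n) (f : laurent R n) : Prop :=
  forall zeta : 'I_n -> R[i], in_G v zeta ->
  forall a : 'rV[int]_n, character zeta a * f@_a = character zeta r * f@_a.

Definition chart (n : nat) (Sigma : {set {set 'I_n}}) :=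
  {sigma : {set 'I_n} | sigma \in Sigma}.

Definition cochain (R : realType) (n : nat) (Sigma : {set {set 'I_n}})
    (p : nat) :=
  {ffun {ffun 'I_p.+1 -> chart Sigma} -> laurent R n}.

Definition cech_cochain (R : realType) (n : nat) (Sigma : {set {set 'I_n}})
    (v : 'I_n -> 'rV[int]_2) (r : 'rV[int]_n) (p : nat)
    (c : cochain R Sigma p) : Prop :=
  forall s : {ffun 'I_p.+1 -> chart Sigma},
    regular_on (\bigcap_k val (s k))%SET (c s) /\ semi_invariant v r (c s).

Definition cech_d (R : realType) (n : nat) (Sigma : {set {set 'I_n}})
    (p : nat) (c : cochain R Sigma p) : cochain R Sigma p.+1 :=
  [ffun s : {ffun 'I_p.+2 -> chart Sigma} =>
     \sum_(k < p.+2) (-1) ^+ k *: c [ffun j => s (lift k j)]].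

Definition cech_cocycle (R : realType) (n : nat) (Sigma : {set {set 'I_n}})
    (v : 'I_n -> 'rV[int]_2) (r : 'rV[int]_n) (j : nat)
    (c : cochain R Sigma j) : Prop :=
  cech_cochain v r c /\ cech_d c = 0.

Definition cech_coboundary (R : realType) (n : nat) (Sigma : {set {set 'I_n}})
    (v : 'I_n -> 'rV[int]_2) (r : 'rV[int]_n) (j : nat) :
    cochain R Sigma j -> Prop :=
  match j with
  | 0%N => fun c => c = 0
  | j'.+1 => fun c =>
      exists b : cochain R Sigma j', cech_cochain v r b /\ c = cech_d b
  end.

Definition cohomology_vanishes (R : realType) (n : nat)
    (Sigma : {set {set 'I_n}}) (v : 'I_n -> 'rV[int]_2) (r : 'rV[int]_n)
    (j : nat) : Prop :=
  forall c : cochain R Sigma j, cech_cocycle v r c -> cech_coboundary v r c.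

Definition H_trivial (R : realType) (n : nat) (Sigma : {set {set 'I_n}})
    (v : 'I_n -> 'rV[int]_2) (r : 'rV[int]_n) : Prop :=
  forall j : nat, cohomology_vanishes R Sigma v r j.

(* Tensoring N^* -> Z^n -> Pic -> 0, w |-> (w . v_i)_i, with R presents       *)
(* Pic_R as the cokernel of N^*_R -> R^n; cl is the quotient map.             *)
Record is_PicR (R : realType) (n : nat) (v : 'I_n -> 'rV[int]_2)
    (V : vectType R) (cl : {linear 'rV[R]_n -> V}) : Prop := {
  PicR_surj : forall y : V, exists x : 'rV[R]_n, cl x = y;
  PicR_ker : forall x : 'rV[R]_n, cl x = 0 <->
    exists w : 'cV[R]_2, x = \row_i pairing w (realify R (v i))
}.

Definition bundle_class (R : realType) (n : nat) (V : vectType R)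
    (cl : {linear 'rV[R]_n -> V}) (r : 'rV[int]_n) : V :=
  cl (realify R r).

Definition enorm (R : realType) (V : vectType R) (ip : {dot V for idfun})
    (x : V) : R := Num.sqrt (ip x x).

Definition edist_to (R : realType) (V : vectType R) (ip : {dot V for idfun})
    (L : {vspace V}) (x : V) : R :=
  inf [set d | exists2 y, y \in L & d = enorm ip (x - y)]%classic.

Definition tube (R : realType) (V : vectType R) (ip : {dot V for idfun})
    (L : {vspace V}) (beta : R) : set V :=
  [set x | edist_to ip L x <= beta]%classic.

Definition origin_ball (R : realType) (V : vectType R)
    (ip : {dot V for idfun}) (rho : R) : set V :=
  [set x | enorm ip x <= rho]%classic.

(* Main.v *)
(* In multidegree a the Cech complex depends only on the signs of the a_i:    *)
(* there is cohomology as soon as all a_i are nonnegative (H^0), all are      *)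
(* negative (H^2), or the signs change at least four times around the fan     *)
(* (H^1). The multidegrees occurring for r are the a_i = r_i + w.v_i with w   *)
(* in N^*. So H-triviality says that no w realizes such a pattern; by         *)
(* rounding, no real w realizes it with all |a_i| larger than some constant.  *)
(*   Choose a real w at which a_i and a_j vanish for neighbouring rays i, j,  *)
(* and let Z be the set of indices at which a is small, small being separated *)
(* from large by a gap. Moving w a little prescribes the signs of the small   *)
(* a_k only. If large a_k of both signs occurred, signs at i and j could be   *)
(* chosen to get four changes; so let all large a_k be positive. Then Z is    *)
(* not contained in an open half plane (all a_k could be made positive), and  *)
(* no large k lies in a sector spanned by two elements of Z (these two could  *)
(* be made negative, and an element of Z outside the sector positive). This   *)
(* leaves two cases: Z contains all rays, so that the class of r is close to  *)
(* O, or Z consists of the rays of a closed half plane bounded by a collinear *)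
(* pair p, q. Repeating this for a neighbour of q on the other side of p, q   *)
(* gives the opposite half plane, unless again the class of r is close to O.  *)
(* Then the class of r is close to a multiple of the class of the divisor     *)
(* with coefficients max(0, - det(v_p, v_i)), which spans the line of the     *)
(* tube of p, q.                                                              *)

Require Import Defs.
From mathcomp Require Import all_boot all_order all_algebra.
From mathcomp Require Import sesquilinear.
From mathcomp Require Import complex.
From mathcomp Require Import boolp classical_sets reals.
From mathcomp Require Import monalg.
From mathcomp Require Import zify ring lra.

Set Implicit Arguments.
Unset Strict Implicit.
Unset Printing Implicit Defensive.

Import Order.TTheory GRing.Theory Num.Theory.

Local Open Scope ring_scope.

(** * Rays of the fan *)

(** Sign patterns that carry cohomology are made into explicit Cech classes ([H0_neq0], [H1_neq0],
    [H2_neq0]). Rounding then turns H-triviality into a condition on real families b, [acyclic]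
    ([H_trivial_acyclic]): no translate of b by a functional shows such a pattern with a fixed
    margin. The rest is plane geometry with constants that depend only on the fan.

    Start from a translate vanishing at two neighbouring rays. A pigeonhole on scales ([gap_ex])
    separates small values from large ones so widely that the signs of the small ones can be moved
    without touching the large ones. The forbidden patterns then leave two cases: all values are
    bounded, or the small ones fill a closed half plane bounded by a collinear pair
    ([half_plane_ex], [half_plane_or_bounded]). Working on both sides of the pair
    ([acyclic_dichotomy]) gives two translates, small on opposite half planes. Their difference is a
    functional nearly vanishing at p, hence nearly a multiple of [D p], so the first translate is
    close to a multiple of max(0, - D p) ([tube_shape]). A bound on coefficients bounds the norm of
    the class ([enorm_class_le]), which puts it in the ball or in a tube. *)

Definition vdet (K : pzRingType) (x y : 'rV[K]_2) : K :=
  x 0 0 * y 0 1 - x 0 1 * y 0 0.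

Definition raydet (n : nat) (v : 'I_n -> 'rV[int]_2) (i j : 'I_n) : int :=
  vdet (v i) (v j).

Lemma row2P (K : Type) (x y : 'rV[K]_2) :
  x 0 0 = y 0 0 -> x 0 1 = y 0 1 -> x = y.
Proof.
move=> h0 h1; apply/rowP => k.
by case: k => -[|[|//]] hk; [move: h0|move: h1];
  congr (_ = _); congr (fun_of_matrix _ _ _); apply/val_inj.
Qed.

Lemma vdet_cramer (K : comPzRingType) (x y z : 'rV[K]_2) :
  vdet y z *: x = vdet x z *: y + vdet y x *: z.
Proof. by apply: row2P; rewrite !mxE /vdet; ring. Qed.

Lemma vdet_sum (K : comPzRingType) (I : finType) (P : pred I) (c : I -> K)
    (x : 'rV[K]_2) (f : I -> 'rV[K]_2) :
  vdet x (\sum_(i | P i) c i *: f i) = \sum_(i | P i) c i * vdet x (f i).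
Proof.
rewrite /vdet !summxE !mulr_sumr -sumrB; apply: eq_bigr => i _.
by rewrite !mxE; ring.
Qed.

Lemma vdet_realify (R : realType) (x y : 'rV[int]_2) :
  vdet (realify R x) (realify R y) = (vdet x y)%:~R.
Proof. by rewrite /vdet !mxE rmorphB !rmorphM. Qed.

Lemma realify_inj (R : realType) m : injective (@realify R m).
Proof.
move=> x y /rowP h; apply/rowP => k.
by have := h k; rewrite !mxE => /intr_inj.
Qed.

Section RayDet.

Variables (n : nat) (v : 'I_n -> 'rV[int]_2).
Let D := raydet v.

Lemma raydetC i j : D j i = - D i j.
Proof. by rewrite /D /raydet /vdet; ring. Qed.

Lemma raydet_self i : D i i = 0.
Proof. by rewrite /D /raydet /vdet; ring. Qed.

Lemma raydet_plucker i j k l : D i j * D k l - D i k * D j l + D i l * D j k = 0.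
Proof. by rewrite /D /raydet /vdet; ring. Qed.

End RayDet.

Section Fan.

Variables (R : realType) (n : nat) (Sigma : {set {set 'I_n}}).
Variable v : 'I_n -> 'rV[int]_2.
Hypothesis hF : complete_stacky_fan R Sigma v.

Local Notation D := (raydet v).
Local Notation vR i := (realify R (v i)).

(** If [i] were not in [sigma], the two cones would meet only in zero, yet both contain the nonzero
    [v i]. *)
Lemma fan_ray_mem (sigma : {set 'I_n}) i :
  sigma \in Sigma -> cone v sigma (vR i) -> i \in sigma.
Proof.
move=> hs hc; apply/negPn/negP => hi.
have : (cone (R := R) v [set i] `&` cone v sigma)%classic (vR i).
  split=> //; exists (fun=> 1); split=> //.
  by rewrite big_set1 scale1r.
rewrite (fan_inter hF (fan_ray hF i) hs).
have -> : [set i] :&: sigma = finset.set0.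
  by apply/setP => k; rewrite !inE; case: eqP => // ->; rewrite (negbTE hi).
case=> c [_]; rewrite big_set0 => h0.
have /eqP := fan_generator_neq0 hF i; apply.
apply: (@realify_inj R); rewrite h0; apply/rowP => k; by rewrite !mxE.
Qed.

(** Parallel vectors are proportional with ratio [e / s], a quotient of inner products; a
    nonnegative ratio would put [v j] on the ray of [v i]. Integer coefficients keep later sign
    arguments in integer arithmetic. *)
Lemma fan_opposite i j : i != j -> D i j = 0 ->
  exists a b : int, [/\ 0 < a, 0 < b & a *: v i + b *: v j = 0].
Proof.
move=> nij h0.
pose e : int := v i 0 0 * v j 0 0 + v i 0 1 * v j 0 1.
pose s : int := v i 0 0 * v i 0 0 + v i 0 1 * v i 0 1.
have s0 : 0 < s.
  have : (v i 0 0 != 0) || (v i 0 1 != 0).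
    apply: contraT; rewrite negb_or !negbK => /andP[/eqP h1 /eqP h2].
    have /eqP[] := fan_generator_neq0 hF i.
    by apply: row2P; rewrite ?h1 ?h2 !mxE.
  rewrite lt0r /s -!expr2 addr_ge0 ?sqr_ge0 // paddr_eq0 ?sqr_ge0 // !sqrf_eq0.
  by rewrite negb_and andbT.
have hE : s *: v j = e *: v i.
  apply: row2P; rewrite !mxE.
    transitivity (e * v i 0 0 - v i 0 1 * D i j); last by rewrite h0; ring.
    by rewrite /e /s /raydet /vdet; ring.
  transitivity (e * v i 0 1 + v i 0 0 * D i j); last by rewrite h0; ring.
  by rewrite /e /s /raydet /vdet; ring.
case: (ltrP e 0) => he.
  by exists (- e), s; split=> //; [lia|rewrite hE scaleNr addNr].
have : j \in [set i].
  apply: (fan_ray_mem (fan_ray hF i)); exists (fun=> e%:~R / s%:~R); split.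
    by move=> _; rewrite divr_ge0 // ler0z // ltW.
  rewrite big_set1.
  have sR : s%:~R != 0 :> R by rewrite intr_eq0 gt_eqF.
  apply: (scalerI sR); rewrite scalerA mulrC divfK //.
  apply/rowP => k; have /rowP/(_ k) := hE; rewrite !mxE => /(congr1 (fun z : int => z%:~R : R)).
  by rewrite !rmorphM.
by rewrite inE eq_sym (negbTE nij).
Qed.

Lemma raydet_opposite i j : i != j -> D i j = 0 ->
  exists a b : int, [/\ 0 < a, 0 < b & forall k, a * D i k + b * D j k = 0].
Proof.
move=> nij h0; have [a [b [ha hb h]]] := fan_opposite nij h0.
exists a, b; split=> // k.
have /rowP h' := h; have := h' 0; have := h' 1; rewrite !mxE /raydet /vdet => h1 h2.
transitivity ((a * v i 0 0 + b * v j 0 0) * v k 0 1 - (a * v i 0 1 + b * v j 0 1) * v k 0 0).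
  by ring.
by rewrite h1 h2; ring.
Qed.

Lemma cone_pair i j k (c1 c2 : R) : i != j -> 0 <= c1 -> 0 <= c2 ->
  k = c1 *: vR i + c2 *: vR j -> cone v [set i; j] k.
Proof.
move=> nij h1 h2 ->; exists (fun m => if m == i then c1 else c2); split.
  by move=> m; case: ifP.
by rewrite big_setU1 ?inE // big_set1 eqxx eq_sym (negbTE nij).
Qed.

(** Cramer's rule writes [v k] as a nonnegative combination of [v i] and [v j]. *)
Lemma fan_empty_sector i j k : [set i; j] \in Sigma ->
  0 < D i j -> 0 <= D i k -> 0 <= D k j -> k = i \/ k = j.
Proof.
move=> hs hij hik hkj.
have nij : i != j by apply: contraTneq hij => ->; rewrite raydet_self ltxx.
have hR : (D i j)%:~R != 0 :> R by rewrite intr_eq0 gt_eqF.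
have : k \in [set i; j].
  apply: (fan_ray_mem hs).
  apply: (@cone_pair _ _ _ ((D k j)%:~R / (D i j)%:~R) ((D i k)%:~R / (D i j)%:~R)) => //.
  - by rewrite divr_ge0 // ler0z // ltW.
  - by rewrite divr_ge0 // ler0z // ltW.
  apply: (scalerI hR); rewrite scalerDr !scalerA ![_ * (_ / _)]mulrC !divfK //.
  by rewrite -!vdet_realify vdet_cramer.
by rewrite !inE => /orP[] /eqP; [left|right].
Qed.

Lemma fan_raydet_neq0 i j : [set i; j] \in Sigma -> i != j -> D i j != 0.
Proof.
move=> hs nij; apply/eqP => h0.
have [a [b [ha hb h]]] := fan_opposite nij h0.
have := fan_simplicial hF hs.
have hp : perm_eq (enum [set i; j]) [:: i; j].
  apply: uniq_perm; rewrite ?enum_uniq //= ?inE ?andbT //.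
  by move=> k; rewrite mem_enum !inE.
rewrite (perm_free (perm_map _ hp)) /= free_cons span_seq1 => /andP[/negP[]].
apply/vlineP; exists (- b%:~R / a%:~R).
have aR : a%:~R != 0 :> R by rewrite intr_eq0 gt_eqF.
apply: (scalerI aR); rewrite scalerA mulrC divfK //.
apply/rowP => k; have /rowP/(_ k) := h; rewrite !mxE => /(congr1 (fun z : int => z%:~R : R)).
by rewrite !rmorphD !rmorphM /= => hh; apply/eqP; rewrite mulNr -subr_eq0 opprK hh.
Qed.

Lemma fan_card (sigma : {set 'I_n}) : sigma \in Sigma -> (#|sigma| <= 2)%N.
Proof.
move=> /(fan_simplicial hF); rewrite /free size_map -cardE => /eqP <-.
by apply: leq_trans (dimvS (subvf _)) _; rewrite dimvf /dim /= mul1n.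
Qed.

Lemma fan_mem_pair (sigma : {set 'I_n}) i j :
  sigma \in Sigma -> i != j -> i \in sigma -> j \in sigma -> sigma = [set i; j].
Proof.
move=> hs nij hi hj; apply/esym/eqP; rewrite eqEcard cards2 nij fan_card //.
by rewrite andbT finset.subUset !finset.sub1set hi hj.
Qed.

Lemma fan_pair (sigma : {set 'I_n}) i j :
  sigma \in Sigma -> i \in sigma -> j \in sigma -> [set i; j] \in Sigma.
Proof.
by move=> hs hi hj; apply: (fan_face hF hs); rewrite finset.subUset !finset.sub1set hi hj.
Qed.

Lemma psumr_gt0_ex (I : finType) (P : pred I) (c d : I -> R) :
  (forall i, 0 <= c i) -> 0 < \sum_(i | P i) c i * d i ->
  exists i, [/\ P i, 0 < c i & 0 < d i].
Proof.
move=> c0 h.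
case: (pselect (exists i, [/\ P i, 0 < c i & 0 < d i])) => // hn.
move: h; rewrite ltNge => /negP[]; apply: sumr_le0 => i hi.
rewrite leNgt; apply/negP => h; apply: hn; exists i; split=> //.
  by rewrite lt_neqAle c0 andbT eq_sym; apply: contraTneq h => ->; rewrite mul0r ltxx.
rewrite ltNge; apply: contraTN h => h; rewrite -leNgt.
by rewrite mulr_ge0_le0.
Qed.

Lemma fan_sector (x y : 'rV[R]_2) : 0 < vdet x y ->
  exists m, 0 < vdet x (vR m).
Proof.
move=> h; have [sigma hs [c [c0 hy]]] := fan_complete hF y.
move: h; rewrite hy vdet_sum => /(psumr_gt0_ex c0)[m [_ _ h]].
by exists m.
Qed.

Lemma fan_inhabited : inhabited 'I_n.
Proof.
have [|m _] := @fan_sector (\row_k (k == 0)%:R) (\row_k (k == 1)%:R).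
  by rewrite /vdet !mxE /= mulr1 mulr0 subr0.
exact: inhabits m.
Qed.

Lemma raydet_pos_ex i : exists m, 0 < D i m.
Proof.
have [k hk] : exists y : 'rV[R]_2, 0 < vdet (vR i) y.
  exists (\row_k (if k == 0 then - (vR i) 0 1 else (vR i) 0 0)).
  rewrite /vdet !mxE /= mulrN opprK.
  have := fan_generator_neq0 hF i.
  case: (eqVneq (v i 0 0) 0) => h0; case: (eqVneq (v i 0 1) 0) => h1.
  - by case/eqP; apply: row2P; rewrite ?h0 ?h1 !mxE.
  - by move=> _; rewrite h0 mul0r add0r -expr2 exprn_even_gt0 //= intr_eq0.
  - by move=> _; rewrite h1 mul0r addr0 -expr2 exprn_even_gt0 //= intr_eq0.
  - by move=> _; rewrite addr_gt0 // -expr2 exprn_even_gt0 //= intr_eq0.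
by have [m +] := fan_sector hk; rewrite vdet_realify ltr0z; exists m.
Qed.

Lemma raydet_neg_ex i : exists m, D i m < 0.
Proof.
have [k hk] : exists y : 'rV[R]_2, vdet (vR i) y < 0.
  have [m hm] := raydet_pos_ex i; exists (- vR m).
  suff -> : vdet (vR i) (- vR m) = - (D i m)%:~R by rewrite oppr_lt0 ltr0z.
  by rewrite -vdet_realify /vdet !mxE; ring.
have [|m hm] := @fan_sector (- vR i) k.
  by move: hk; rewrite /vdet !mxE; lra.
exists m; move: hm; rewrite -(ltrz0 R) -vdet_realify /vdet !mxE; lra.
Qed.

End Fan.

(** Totality and transitivity are asked only on [S], because comparing angles by the sign of a
    determinant is not transitive around a full turn. *)
Lemma exists_least (T : finType) (S : pred T) (le : rel T) (x0 : T) : S x0 ->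
  (forall x y, S x -> S y -> le x y \/ le y x) ->
  (forall y x z, S x -> S y -> S z -> le x y -> le y z -> le x z) ->
  exists2 e, S e & forall z, S z -> le e z.
Proof.
move=> Sx0 tot tr.
case: (arg_maxnP (fun e => #|[pred z | S z && le e z]|) Sx0) => e Se emax.
exists e => // z Sz; apply: contraT => nez.
have lze : le z e by case: (tot _ _ Sz Se) => // h; rewrite h in nez.
have := emax z Sz; rewrite /= leqNgt => /negP[]; apply: proper_card.
apply/properP; split.
  apply/fintype.subsetP => t; rewrite !inE => /andP[St let_]; rewrite St /=.
  exact: tr let_.
exists z; rewrite !inE Sz //=.
by case: (tot _ _ Sz Sz).
Qed.

(** * Cyclic order of the rays *)

Section Cyclic.

Variables (n : nat) (v : 'I_n -> 'rV[int]_2).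
Local Notation D := (raydet v).

(* Of the three positively oriented angles ab, bc, ca, which add up to a      *)
(* full turn, at most one is not less than a half turn.                       *)
Definition ccw (a b c : 'I_n) : bool :=
  [|| (0 < D a b) && (0 < D b c), (0 < D b c) && (0 < D c a)
    | (0 < D c a) && (0 < D a b)].

Lemma ccw_rot a b c : ccw a b c = ccw b c a.
Proof. by rewrite /ccw orbC -orbA. Qed.

Lemma ccw_asym a b c : ccw a b c -> ccw a c b = false.
Proof.
have := (raydetC v a b, raydetC v b c, raydetC v c a); rewrite /ccw => -[[]].
by lia.
Qed.

(** The arcs from [k] to [j] and from [j] to [k] make up the circle. Sign patterns violating the
    conclusion contradict the Plücker relation. *)
Lemma ccw_trans k x j y : ccw k x j -> ccw j y k -> ccw x j y.
Proof.
have := raydet_plucker v k x j y; rewrite /ccw.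
have := (raydetC v x y, raydetC v y k, raydetC v j k) => -[[-> ->] ->].
rewrite !oppr_gt0.
move=> pl /or3P[]/andP[h1 h2] /or3P[]/andP[h3 h4]; rewrite ?h1 ?h2 ?h3 ?h4 ?orbT //=.
all: apply/or3P.
all: case: (ltrP 0 (D x j)) => a1; case: (ltrP 0 (D j y)) => a2; case: (ltrP (D x y) 0) => a3; try by [constructor 1|constructor 2|constructor 3].
all: exfalso; clear - pl h1 h2 h3 h4 a1 a2 a3; nia.
Qed.

End Cyclic.

Section FanOrder.

Variables (R : realType) (n : nat) (Sigma : {set {set 'I_n}}).
Variable v : 'I_n -> 'rV[int]_2.
Hypothesis hF : complete_stacky_fan R Sigma v.

Local Notation D := (raydet v).
Local Notation vR i := (realify R (v i)).
Local Notation cyc := (ccw v).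

Lemma raydet_gt0_neq i j : 0 < D i j -> i != j.
Proof. by apply: contraTneq => ->; rewrite raydet_self ltxx. Qed.

(** Three rays on one line would be pairwise opposite; combining the three relations cancels [v j]
    and [v k] and leaves a positive multiple of [v i]. *)
Lemma raydet_line i j k : i != j -> i != k -> j != k ->
  D i j = 0 -> D i k != 0.
Proof.
move=> nij nik njk hij; apply/eqP => hik.
have [a [b [a0 b0 h]]] := fan_opposite hF nij hij.
have [a' [b' [a'0 b'0 h']]] := fan_opposite hF nik hik.
have hjk : D j k = 0.
  have [c [d [c0 d0 hcd]]] := raydet_opposite hF nij hij.
  have := hcd k; rewrite hik; nia.
have [c [d [c0 d0 hcd]]] := fan_opposite hF njk hjk.
have /eqP[] := fan_generator_neq0 hF i.
apply/rowP => m.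
have /rowP/(_ m) := h; have /rowP/(_ m) := h'; have /rowP/(_ m) := hcd.
rewrite !mxE => e3 e2 e1.
have p : 0 < c * a * b' + d * a' * b by rewrite addr_gt0 // !mulr_gt0.
apply/(mulfI (lt0r_neq0 p)); rewrite mulr0.
transitivity (c * b' * (a * v i 0 m + b * v j 0 m)
  + d * b * (a' * v i 0 m + b' * v k 0 m) - b * b' * (c * v j 0 m + d * v k 0 m)).
  by ring.
by rewrite e1 e2 e3 !mulr0 addr0 subr0.
Qed.

Lemma ccw_total a b c : a != b -> b != c -> c != a -> cyc a b c || cyc a c b.
Proof.
move=> nab nbc nca.
wlog hbc : a b c nab nbc nca / D a b = 0 -> D b c = 0 /\ D c a = 0.
  move=> H.
  case: (eqVneq (D a b) 0) => h1; last by apply: H => // /eqP; rewrite (negbTE h1).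
  have h2 : D b c != 0.
    apply: (raydet_line (j := a)) => //; [by rewrite eq_sym|by rewrite eq_sym|].
    by rewrite raydetC h1 oppr0.
  by have := H b c a nbc nca nab; rewrite (ccw_rot v a b c) (ccw_rot v b a c) 
    (ccw_rot v a c b) => -> // /eqP; rewrite (negbTE h2).
case: (eqVneq (D a b) 0) => h1.
  have [_ h2] := hbc h1.
  have := @raydet_line a b c nab; rewrite eq_sym nca nbc h1 => /(_ isT isT erefl).
  by rewrite raydetC h2 oppr0 eqxx.
case: (eqVneq (D b c) 0) => h2.
  have [x [y [x0 y0 h]]] := raydet_opposite hF nbc h2.
  have := h a; move: h1; rewrite /ccw.
  by rewrite (raydetC v a b) (raydetC v c a) (raydetC v b c); nia.
case: (eqVneq (D c a) 0) => h3.
  have [x [y [x0 y0 h]]] := raydet_opposite hF nca h3.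
  have := h b; move: h1; rewrite /ccw.
  by rewrite (raydetC v a b) (raydetC v c a) (raydetC v b c); nia.
rewrite /ccw (raydetC v a b) (raydetC v c a) (raydetC v b c).
move: h1 h2 h3; rewrite (raydetC v a c); lia.
Qed.

Lemma ccw_pos a b c : 0 < D a c -> cyc a b c = (0 < D a b) && (0 < D b c).
Proof. by rewrite /ccw (raydetC v a c); lia. Qed.

Lemma fan_not_ccw i j k : [set i; j] \in Sigma -> 0 < D i j -> ~~ cyc i k j.
Proof.
move=> hs hij; rewrite ccw_pos //; apply/negP => /andP[h1 h2].
case: (fan_empty_sector hF hs hij (ltW h1) (ltW h2)) => h; move: h1 h2;
  by rewrite h raydet_self ltxx.
Qed.

(** Let [j] be the first ray after [i] within a half turn, and take a cone containing [v i + v j].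
    It has a ray [m] on the positive side of [v i] and a ray [l] clockwise from [v i + v j]. By the
    choice of [j], [v i] lies in the sector from [l] to [m], so [i = l]. *)
Lemma exists_next i : exists j, 0 < D i j /\ [set i; j] \in Sigma.
Proof.
have [j0 hj0] := raydet_pos_ex hF i.
have [||j hj jmin] := @exists_least _ (fun j => 0 < D i j) (fun x y => 0 <= D x y) j0 hj0.
- move=> x y _ _; rewrite (raydetC v x y); case: (lerP 0 (D x y)); lia.
- move=> y x z; have := raydet_plucker v i x y z; nia.
have [sigma hs [c [c0 hx]]] := fan_complete hF (vR i + vR j).
have hd m : vdet (vR i + vR j) (vR m) = (D i m + D j m)%:~R.
  by rewrite intrD /raydet -!vdet_realify /vdet !mxE; ring.
have [m [hm cm him]] : exists m, [/\ m \in sigma, 0 < c m & 0 < vdet (vR i) (vR m)].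
  apply: psumr_gt0_ex => //; rewrite -vdet_sum -hx.
  have -> : vdet (vR i) (vR i + vR j) = (D i j)%:~R.
    by rewrite /raydet -!vdet_realify /vdet !mxE; ring.
  by rewrite ltr0z.
move: him; rewrite vdet_realify ltr0z -/(raydet v i m) => him.
have hjm := jmin _ him.
(* The determinant of the sum with itself is zero and [m] contributes a positive term, so another
   ray contributes a negative one. *)
have [l [hl cl hil]] : exists l, [/\ l \in sigma, 0 < c l & 0 < - vdet (vR i + vR j) (vR l)].
  case: (pselect (exists l, [/\ l \in sigma, 0 < c l & 0 < - vdet (vR i + vR j) (vR l)])) => // hn.
  suff : 0 < vdet (vR i + vR j) (vR i + vR j) by rewrite /vdet mulrC subrr ltxx.
  rewrite {2}hx vdet_sum (bigD1 m) //=; apply: ltr_wpDr.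
    apply: sumr_ge0 => l /andP[hl _].
    case: (eqVneq (c l) 0) => [->|ncl]; first by rewrite mul0r.
    rewrite mulr_ge0 // leNgt; apply/negP => h; apply: hn; exists l.
    by rewrite oppr_gt0 lt0r ncl c0.
  by rewrite mulr_gt0 // hd ltr0z ltr_wpDr.
move: hil; rewrite hd -rmorphN ltr0z => hil.
have hli : 0 <= D l i.
  rewrite leNgt; apply/negP; rewrite (raydetC v i l) oppr_lt0 => h.
  by have := jmin _ h => /=; lia.
have nlm : l != m by apply: contraTneq hil => ->; lia.
have sE := fan_mem_pair hF hs nlm hl hm.
have hlm : 0 < D l m.
  have : vdet (vR i + vR j) (vR m) = c l * (D l m)%:~R.
    rewrite {1}hx sE big_setU1 ?inE // big_set1 /raydet -vdet_realify.
    by rewrite /vdet !mxE; ring.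
  rewrite hd => h; rewrite -(ltr0z R) -(pmulr_rgt0 _ cl) -h ltr0z; lia.
rewrite sE in hs.
case: (fan_empty_sector hF hs hlm hli (ltW him)) => E.
  by exists m; rewrite E; split=> //; rewrite -E.
by move: him; rewrite E raydet_self.
Qed.

End FanOrder.

(** * Cohomology classes from sign patterns *)

Section Cech.

Variables (R : realType) (n : nat) (Sigma : {set {set 'I_n}}).
Variable v : 'I_n -> 'rV[int]_2.
Variables (r a : 'rV[int]_n) (w : 'cV[int]_2).
Hypothesis ha : forall i, a 0 i = r 0 i + pairing w (v i).

Local Notation C := (chart Sigma).

(** Listing the charts of a simplex lets its faces be computed on explicit short lists. *)
Definition tuple_of (p : nat) (x : C) (s : seq C) : {ffun 'I_p.+1 -> C} :=
  [ffun j : 'I_p.+1 => nth x s j].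

Lemma tuple_ofP p x (s : {ffun 'I_p.+1 -> C}) :
  exists2 l, size l = p.+1 & s = tuple_of p x l.
Proof.
exists (fgraph s); first by rewrite size_tuple card_ord.
by apply/ffunP => j; rewrite ffunE nth_fgraph_ord.
Qed.

Lemma face_tuple_of p x l (k : 'I_p.+2) : size l = p.+2 ->
  [ffun j => tuple_of p.+1 x l (lift k j)]
    = tuple_of p x (take k l ++ drop k.+1 l).
Proof.
move=> sl; apply/ffunP => j; rewrite !ffunE nth_cat size_takel; last first.
  by rewrite sl ltnW.
rewrite /= /bump; case: ltnP => hk; first by rewrite nth_take // leqNgt hk.
by rewrite nth_drop addSn subnKC.
Qed.

Lemma cech_d_coef p (b : cochain R Sigma p) x l k : size l = p.+2 ->
  (cech_d b (tuple_of p.+1 x l))@_k =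
  \sum_(i < p.+2) (-1) ^+ i * (b (tuple_of p x (take i l ++ drop i.+1 l)))@_k.
Proof.
move=> sl; rewrite ffunE raddf_sum /=; apply: eq_bigr => i _.
by rewrite mcoeffZ face_tuple_of.
Qed.

Definition monochain (p : nat) (f : seq C -> R[i]) : cochain R Sigma p :=
  [ffun s : {ffun 'I_p.+1 -> C} => << f (fgraph s) *g a >>].

Lemma monochainE p f x l k : size l = p.+1 ->
  (monochain p f (tuple_of p x l))@_k = f l *+ (a == k).
Proof.
move=> sl; rewrite ffunE mcoeffU; congr (f _ *+ _).
apply: (@eq_from_nth _ x); first by rewrite size_tuple card_ord.
move=> i hi; have {}hi : (i < p.+1)%N by rewrite size_tuple card_ord in hi.
by rewrite (nth_fgraph_ord x (Ordinal hi)) ffunE.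
Qed.

(** The exponents [a] and [r] define the same character of G, so only regularity constrains [f]. *)
Lemma monochain_cech p (f : seq C -> R[i]) :
  (forall l : seq C, size l = p.+1 -> f l != 0 ->
     forall i, (forall s, s \in l -> i \in val s) -> 0 <= a 0 i) ->
  cech_cochain v r (monochain p f).
Proof.
move=> hf s; split=> [b|zeta [z0 hz] b].
  rewrite ffunE mcoeffU; case: (a =P b) => [<-|_]; last by rewrite eqxx.
  rewrite mulr1n => fn0 i /bigcapP hi.
  apply: (hf _ _ fn0) => [|t ht]; first by rewrite size_tuple card_ord.
  have [j ->] : exists j, t = s j.
    by case/codomP: (ht : t \in codom s) => j ->; exists j.
  exact: hi.
rewrite ffunE mcoeffU; case: (a =P b) => [<-|_]; last by rewrite !mulr0.
congr (_ * _); rewrite /character.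
under eq_bigr => i _ do rewrite ha expfzDr //.
by rewrite big_split /= hz mulr1.
Qed.

Lemma cech_coef_eq0 p (b : cochain R Sigma p) x (l : seq C) i : cech_cochain v r b ->
  size l = p.+1 -> (forall s, s \in l -> i \in val s) -> a 0 i < 0 ->
  (b (tuple_of p x l))@_a = 0.
Proof.
move=> hb sl hi ai; apply/eqP; apply: contraTT ai => nz; rewrite -leNgt.
apply: ((hb _).1 _ nz); apply/bigcapP => j _.
by rewrite ffunE; apply: hi; rewrite mem_nth // sl.
Qed.

Lemma monochain_cocycle p (f : seq C -> R[i]) :
  (forall l : seq C, size l = p.+2 ->
     \sum_(i < p.+2) (-1) ^+ i * f (take i l ++ drop i.+1 l) = 0) ->
  cech_d (monochain p f) = 0.
Proof.
move=> hf; apply/ffunP => s; apply/malgP => k; rewrite [in RHS]ffunE mcoeff0.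
have x := s 0; have [l sl ->] := tuple_ofP x s.
rewrite cech_d_coef //.
transitivity ((\sum_(i < p.+2) (-1) ^+ i * f (take i l ++ drop i.+1 l)) *+ (a == k)).
  rewrite -sumrMnl; apply: eq_bigr => i _.
  have si : size (take i l ++ drop i.+1 l) = p.+1.
    have hi := ltn_ord i; rewrite size_cat size_drop size_takel sl; last exact: ltnW.
    by rewrite subSS subnKC.
  by rewrite (monochainE f _ _ si) mulrnAr.
by rewrite hf // mul0rn.
Qed.

Hypothesis hF : complete_stacky_fan R Sigma v.

Lemma H0_neq0 : (forall i, 0 <= a 0 i) -> ~ cohomology_vanishes R Sigma v r 0.
Proof.
move=> a0 /(_ (monochain 0 (fun=> 1))) H.
have /H {H} : cech_cocycle v r (monochain 0 (fun=> 1)).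
  split; first by apply: monochain_cech => l _ _ i _.
  apply: monochain_cocycle => l _.
  by rewrite !big_ord_recl big_ord0 /=; ring.
have [sigma hs _] := fan_complete hF 0.
move/ffunP => /(_ (tuple_of 0 (exist _ sigma hs) [:: exist _ sigma hs])).
move/malgP => /(_ a); rewrite monochainE // ffunE mcoeff0 eqxx => /eqP.
by rewrite oner_eq0.
Qed.

(** The class is the formal coboundary of [phi], which marks the charts meeting [A]. By the
    separation hypothesis [phi] is constant on charts sharing a ray with negative exponent, so the
    difference is regular. A primitive has coefficient zero on the charts [[set x]] and [[set y]],
    where [phi] takes different values. *)
Lemma H1_neq0 (A : {set 'I_n}) x y :
  x \in A -> a 0 x < 0 -> y \notin A -> a 0 y < 0 ->
  (forall i j, i \in A -> j \notin A -> a 0 j < 0 -> [set i; j] \notin Sigma) ->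
  ~ cohomology_vanishes R Sigma v r 1.
Proof.
move=> xA ax yA ay sep.
pose sx : C := exist _ [set x] (fan_ray hF x).
pose sy : C := exist _ [set y] (fan_ray hF y).
pose phi (s : C) : R[i] := [exists i in A, i \in val s]%:R.
pose f (l : seq C) := phi (nth sx l 1) - phi (nth sx l 0).
move=> /(_ (monochain 1 f)) H.
have /H {H} : cech_cocycle v r (monochain 1 f).
  split.
    apply: monochain_cech => -[|s [|t [|]]] // _ fn0 i hi.
    rewrite leNgt; apply: contra fn0 => ai; rewrite subr_eq0 /=; apply/eqP.
    have [si ti] : i \in val s /\ i \in val t.
      by split; apply: hi; rewrite !inE eqxx ?orbT.
    congr (_%:R); case iA: (i \in A).
      by congr nat_of_bool; transitivity true; [|symmetry];
        apply/existsP; exists i; rewrite iA ?si ?ti.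
    have no (u : C) : i \in val u -> [exists i in A, i \in val u] = false.
      move=> iu; apply/negbTE/negP => /existsP[j /andP[jA ju]].
      have /negP := sep j i jA (negbT iA) ai; apply.
      by apply: (fan_pair hF (sigma := val u)) => //; exact: (valP u).
    by rewrite !no.
  apply: monochain_cocycle => -[|s [|t [|u [|]]]] // _.
  by rewrite !big_ord_recl big_ord0 /= /bump /= /f /=; ring.
case=> b [hb /ffunP /(_ (tuple_of 1 sx [:: sx; sy]))].
move/malgP => /(_ a); rewrite monochainE // cech_d_coef // eqxx mulr1n.
rewrite !big_ord_recl big_ord0 /= /bump /=.
rewrite (@cech_coef_eq0 _ _ _ _ y hb) //; last by move=> s; rewrite !inE => /eqP ->; rewrite /= inE.
rewrite (@cech_coef_eq0 _ _ _ _ x hb) //; last by move=> s; rewrite !inE => /eqP ->; rewrite /= inE.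
rewrite /f /phi /=.
have -> : [exists i in A, i \in [set x]] = true by apply/existsP; exists x; rewrite xA inE /=.
have -> : [exists i in A, i \in [set y]] = false.
  by apply/negbTE/negP => /existsP[j /andP[jA]]; rewrite inE => /eqP E; rewrite -E jA in yA.
by rewrite !mulr0 !addr0 sub0r => /eqP; rewrite oppr_eq0 oner_eq0.
Qed.

Local Notation D := (raydet v).

Lemma exists_next_fun : exists f : 'I_n -> 'I_n,
  injective f /\ forall i, 0 < D i (f i) /\ [set i; f i] \in Sigma.
Proof.
have [f hf] := choice (exists_next hF).
exists f; split=> // i j eij.
wlog h : i j eij / 0 <= D i j.
  by move=> H; case: (lerP 0 (D i j)) => h; [|symmetry]; apply: H => //;
    rewrite raydetC oppr_ge0 ltW.
have [hi si] := hf i; have [hj _] := hf j; rewrite -eij in hj.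
case: (fan_empty_sector hF si hi h (ltW hj)) => // E.
by move: hj; rewrite E raydet_self.
Qed.

(* The class is the connecting image of the 1-cochain theta, a cocycle on     *)
(* pairs of meeting charts that is not exact: going once around the rays      *)
(* changes a primitive of theta by 1, at the step from p to {p, q}.           *)
Lemma H2_neq0 : (forall i, a 0 i < 0) -> ~ cohomology_vanishes R Sigma v r 2.
Proof.
move=> aneg.
have [nxt [nxt_inj hnxt]] := exists_next_fun.
have [p] := fan_inhabited hF; pose q := nxt p.
have [hpq sE] := hnxt p; rewrite -/q in hpq sE.
have npq : p != q by exact: raydet_gt0_neq hpq.
pose ch i : C := exist _ [set i] (fan_ray hF i).
pose E : C := exist _ [set p; q] sE.
pose theta (s t : C) : R[i] :=
  if (p \in val s) && (p \in val t) then (t == E)%:R - (s == E)%:R else 0.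
have theta0 i (s t : C) : i != p -> i \in val s -> i \in val t -> theta s t = 0.
  move=> nip si ti; rewrite /theta; case: ifP => // /andP[sp tp].
  have -> : s = t; last by rewrite subrr.
  apply: val_inj; rewrite (fan_mem_pair hF (valP s) nip si sp).
  by rewrite (fan_mem_pair hF (valP t) nip ti tp).
pose x := ch p.
pose f (l : seq C) := theta (nth x l 1) (nth x l 2)
  - theta (nth x l 0) (nth x l 2) + theta (nth x l 0) (nth x l 1).
move=> /(_ (monochain 2 f)) H.
have /H {H} : cech_cocycle v r (monochain 2 f).
  split.
    apply: monochain_cech => -[|s [|t [|u [|]]]] // _ /eqP fn0 i hi.
    have [si ti ui] : [/\ i \in val s, i \in val t & i \in val u].
      by split; apply: hi; rewrite !inE eqxx ?orbT.
    case: fn0; rewrite /f /=; case: (eqVneq i p) => [ip|nip]; last first.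
      by rewrite !(theta0 i) // subr0 addr0.
    by rewrite /theta -!ip si ti ui /=; ring.
  apply: monochain_cocycle => -[|s [|t [|u [|y [|]]]]] // _.
  by rewrite !big_ord_recl big_ord0 /= /bump /= /f /=; ring.
case=> b [hb /ffunP hd].
(* [h] is a cocycle on all triples of charts, hence the difference of a potential [g]; on charts
   sharing a ray the coefficient of [b] vanishes and [h] is [theta]. *)
pose h (s t : C) := theta s t - (b (tuple_of 1 x [:: s; t]))@_a.
have hcl (s t u : C) : h t u - h s u + h s t = 0.
  have /malgP /(_ a) := hd (tuple_of 2 x [:: s; t; u]).
  rewrite monochainE // cech_d_coef // eqxx mulr1n.
  rewrite !big_ord_recl big_ord0 /= /bump /= /f /h /= => e.
  by move/eqP: e; rewrite -subr_eq0 => /eqP e; rewrite -[RHS]e; ring.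
pose g (s : C) := h x s.
have hg i (s t : C) : i \in val s -> i \in val t -> theta s t = g t - g s.
  move=> si ti; have := hcl x s t; rewrite {1}/h (cech_coef_eq0 (i := i) _ hb) //.
    by rewrite subr0 -/(g t) -/(g s) => e; apply/eqP; rewrite -subr_eq0 -e; apply/eqP; ring.
  by move=> u; rewrite !inE => /orP[] /eqP ->.
have gE i : g (ch (nxt i)) = g (ch i) + (i == p)%:R.
  have [hi si] := hnxt i; pose F : C := exist _ [set i; nxt i] si.
  have h1 := @hg i (ch i) F; have h2 := @hg (nxt i) F (ch (nxt i)).
  have t2 : theta F (ch (nxt i)) = 0.
    rewrite /theta /= !inE; case: ifP => // /andP[_ /eqP pE].
    have -> : (ch (nxt i) == E) = false.
      apply/negP => /eqP /(congr1 val) /= /setP /(_ q); rewrite !inE eqxx orbT -pE.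
      by rewrite eq_sym (negbTE npq).
    have -> : (F == E) = false; last by rewrite subrr.
    apply/negP => /eqP /(congr1 val) /= /setP /(_ i); rewrite !inE eqxx /=.
    move/esym/orP=> [] /eqP ei.
      by move: hi; rewrite -pE ei raydet_self.
    by move: hi; rewrite -pE ei (raydetC v p q) oppr_gt0 ltNge ltW.
  have t1 : theta (ch i) F = (i == p)%:R.
    rewrite /theta /= !inE; case: (eqVneq i p) => [ip|nip] //=.
    have -> : F == E by apply/eqP/val_inj; rewrite /= ip.
    have -> : (ch i == E) = false; last by rewrite subr0.
    apply/negP => /eqP /(congr1 val) /= /setP /(_ q); rewrite !inE eqxx orbT ip.
    by rewrite eq_sym (negbTE npq).
  move: h1 h2; rewrite t1 t2 /= !inE !eqxx orbT => /(_ isT isT) -> /(_ isT isT) e.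
  by rewrite addrC subrK; apply/eqP; rewrite -subr_eq0 -e.
(* The jump occurs at the first step only, since the orbit does not meet [p] again before closing
   up; at closure this reads g = g + 1. *)
have hcyc m : (0 < m <= order nxt p)%N -> g (ch (iter m nxt p)) = g (ch p) + 1.
  elim: m => // m IH /andP[_ hm]; rewrite iterS gE.
  case: m IH hm => [_ _|m IH hm]; first by rewrite /= (eqxx p).
  have {}IH := IH (ltnW hm); rewrite {}IH.
  case: eqP => [e|_]; last by rewrite addr0.
  by have := findex_iter hm; rewrite e findex0.
have := hcyc (order nxt p); rewrite order_gt0 leqnn iter_order // => /(_ isT) /eqP.
by rewrite -subr_eq0 opprD addrA subrr sub0r oppr_eq0 oner_eq0.
Qed.

End Cech.

(** * Sets of rays closed under sectors *)

Section HalfPlane.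

Variables (R : realType) (n : nat) (Sigma : {set {set 'I_n}}).
Variable v : 'I_n -> 'rV[int]_2.
Hypothesis hF : complete_stacky_fan R Sigma v.

Local Notation D := (raydet v).

Lemma raydet_opposite_sign p q k : p != q -> D p q = 0 ->
  (0 < D q k) = (D p k < 0).
Proof. by move=> npq h; have [a [b [a0 b0 /(_ k)]]] := raydet_opposite hF npq h; nia. Qed.

Lemma raydet_opposite_neg p q k : p != q -> D p q = 0 ->
  (D q k < 0) = (0 < D p k).
Proof.
move=> npq hpq; rewrite -(@raydet_opposite_sign q p) // 1?eq_sym //.
by rewrite raydetC hpq oppr0.
Qed.

Variable Z : pred 'I_n.
Hypothesis sector_mem : forall z1 z2 k, Z z1 -> Z z2 ->
  0 < D z1 k -> 0 < D k z2 -> 0 < D z1 z2 -> Z k.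

(** For [k] outside [Z], a positive determinant with one vertex propagates to the next, so either
    all three are positive or none is. A positive combination of them vanishes, so all are zero,
    which is impossible. *)
Lemma triangle_full x y z : Z x -> Z y -> Z z ->
  0 < D x y -> 0 < D y z -> 0 < D z x -> forall k, Z k.
Proof.
move=> Zx Zy Zz hxy hyz hzx k; apply/negPn/negP => nk.
have nZ t : Z t -> t != k by apply: contraTneq => ->.
have [nx ny nz] := And3 (nZ x Zx) (nZ y Zy) (nZ z Zz).
have pl : D y z * D x k + D z x * D y k + D x y * D z k = 0.
  by rewrite /raydet /vdet; ring.
have H s t : Z s -> Z t -> 0 < D s t -> 0 < D s k -> 0 < D t k.
  move=> Zs Zt hst hsk; case: (ltrgtP (D t k) 0) => // h.
    by case/negP: nk; apply: (sector_mem Zs Zt hsk _ hst); rewrite raydetC oppr_gt0.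
  have := raydet_opposite_sign s (nZ t Zt) h.
  by rewrite (raydetC v s t) (raydetC v s k); lia.
have := H x y Zx Zy hxy; have := H y z Zy Zz hyz; have := H z x Zz Zx hzx.
have : D x k != 0 \/ D y k != 0.
  case: (eqVneq (D x k) 0) => h; last by left.
  right; rewrite raydetC oppr_eq0; apply: (raydet_line hF (j := x)).
  - by rewrite eq_sym.
  - by rewrite eq_sym.
  - by rewrite (raydet_gt0_neq hxy).
  - by rewrite raydetC h oppr0.
nia.
Qed.

(** If [s] and [z] are not opposite, they form a triangle around the origin with [p] or [q];
    otherwise the four sectors of the cross cover the plane. *)
Lemma cross_full p q s z : Z p -> Z q -> Z s -> Z z ->
  p != q -> D p q = 0 -> 0 < D p s -> D p z < 0 -> forall k, Z k.
Proof.
move=> Zp Zq Zs Zz npq hpq hps hpz k; apply/negPn/negP => nk.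
have nZ t : Z t -> t != k by apply: contraTneq => ->.
have nsz : s != z by apply: contraTneq hps => ->; lia.
have S t := raydet_opposite_sign t npq hpq.
have hqs : D q s < 0 by rewrite (raydet_opposite_neg s npq hpq).
have hqz : 0 < D q z by rewrite S.
case: (ltrgtP (D s z) 0) => hsz.
- move/negP: nk; apply; apply: (@triangle_full q z s) => //.
    by rewrite raydetC oppr_gt0.
  by rewrite raydetC oppr_gt0.
- move/negP: nk; apply; apply: (@triangle_full p s z) => //.
  by rewrite raydetC oppr_gt0.
have npk := raydet_line hF npq (nZ _ Zp) (nZ _ Zq) hpq.
have nsk := raydet_line hF nsz (nZ _ Zs) (nZ _ Zz) hsz.
have hsk := raydet_opposite_sign k nsz hsz.
have Mk a b : Z a -> Z b -> 0 < D a k -> D b k < 0 -> D b a < 0 -> False.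
  move=> Za Zb h1 h2 h3; move/negP: nk; apply; apply: (sector_mem Za Zb h1).
    by rewrite raydetC oppr_gt0.
  by rewrite raydetC oppr_gt0.
have hqk := raydet_opposite_neg k npq hpq.
have hzk := raydet_opposite_neg k nsz hsz.
case: (ltrgtP (D p k) 0) => hpk; last by rewrite hpk eqxx in npk.
  have qk : 0 < D q k by rewrite S.
  case: (ltrgtP (D s k) 0) => hs; last by rewrite hs eqxx in nsk.
    apply: (Mk z p) => //; first by rewrite hsk.
  by apply: (Mk q z) => //; [rewrite hzk|rewrite raydetC oppr_lt0].
have qk : D q k < 0 by rewrite hqk.
case: (ltrgtP (D s k) 0) => hs; last by rewrite hs eqxx in nsk.
  by apply: (Mk p s) => //; rewrite raydetC oppr_lt0.
by apply: (Mk s q).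
Qed.

(** Without opposite pairs or triangles around the origin, angle orders [Z] linearly. With [e1]
    first and [e2] last, [D e1 - D e2] is a positive integer on [Z], contrary to the hypothesis,
    which says that [Z] fits in no open half plane. *)
Lemma opposite_pair_ex i j : Z i -> Z j -> 0 < D i j ->
  (forall e1 e2, Z e1 -> Z e2 -> ~ (forall z, Z z -> 1 <= D e1 z - D e2 z)) ->
  (forall x y z, Z x -> Z y -> Z z ->
     0 < D x y -> 0 < D y z -> 0 < D z x -> False) ->
  exists p q, [/\ Z p, Z q, p != q & D p q = 0].
Proof.
move=> Zi Zj hij npos ntri.
case: (pselect (exists p q, [/\ Z p, Z q, p != q & D p q = 0])) => // nopp.
have eq0 x y : Z x -> Z y -> D x y = 0 -> x = y.
  move=> Zx Zy h; apply/eqP/negPn/negP => nxy; apply: nopp; exists x, y.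
  by split.
have tot x y : Z x -> Z y -> 0 <= D x y \/ 0 <= D y x.
  by move=> _ _; rewrite (raydetC v x y); case: (lerP 0 (D x y)); lia.
have tr y x z : Z x -> Z y -> Z z -> 0 <= D x y -> 0 <= D y z -> 0 <= D x z.
  move=> Zx Zy Zz; rewrite !le_eqVlt => /orP[/eqP/esym/(eq0 _ _ Zx Zy)->|h1] //.
  case/orP=> [/eqP/esym/(eq0 _ _ Zy Zz)<-|h2]; first by rewrite h1 orbT.
  rewrite -le_eqVlt leNgt; apply/negP => h; apply: (ntri x y z) => //.
  by rewrite raydetC oppr_gt0.
have [e1 Ze1 m1] := exists_least Zi tot tr.
have [||e2 Ze2 m2] := @exists_least _ Z (fun x y => 0 <= D y x) i Zi.
- by move=> x y Zx Zy; apply/or_comm/tot.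
- by move=> y x z Zx Zy Zz h1 h2; apply: (tr y).
case: (npos e1 e2 Ze1 Ze2) => z Zz.
have h1 := m1 z Zz; have h2 := m2 z Zz; rewrite raydetC in h2.
case: (eqVneq (D e1 z) 0) => [/(eq0 _ _ Ze1 Zz) E1|]; last by lia.
case: (eqVneq (D e2 z) 0) => [/(eq0 _ _ Ze2 Zz) E2|]; last by lia.
have E t : Z t -> t = z.
  move=> Zt; apply: eq0 => //.
  by have := m1 t Zt; have := m2 t Zt; rewrite E1 E2 (raydetC v t z); lia.
by move: hij; rewrite (E i) // (E j) // raydet_self.
Qed.

(** [Z] contains an opposite pair and a ray [s] off its line. Sectors through [s] fill that side,
    and any element on the other side would make [Z] everything by [cross_full]. *)
Lemma half_plane_ex i j k0 : Z i -> Z j -> 0 < D i j -> ~~ Z k0 ->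
  (forall e1 e2, Z e1 -> Z e2 -> ~ (forall z, Z z -> 1 <= D e1 z - D e2 z)) ->
  exists p q, [/\ p != q, D p q = 0 & forall k, Z k = (0 <= D p k)].
Proof.
move=> Zi Zj hij nk0 npos.
have nfull : ~ forall k, Z k by move=> h; rewrite h in nk0.
have [|p [q [Zp Zq npq hpq]]] := opposite_pair_ex Zi Zj hij npos.
  by move=> x y z Zx Zy Zz h1 h2 h3; apply: nfull; apply: (triangle_full Zx Zy Zz).
have [s Zs hps] : exists2 s, Z s & D p s != 0.
  case: (eqVneq (D p i) 0) => hi; last by exists i.
  exists j => //.
  have nij := raydet_gt0_neq hij.
  case: (eqVneq p i) => [->|npi]; first by rewrite gt_eqF.
  case: (eqVneq p j) => [pj|npj].
    by move: hij; rewrite raydetC -pj hi oppr0.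
  exact: (raydet_line hF npi npj nij hi).
wlog {hps} hps : p q Zp Zq npq hpq / 0 < D p s.
  move=> H; case: (ltrgtP (D p s) 0) hps => // hps _; last by apply: (H p q).
  apply: (H q p) => //; [by rewrite eq_sym|by rewrite raydetC hpq oppr0|].
  by rewrite (raydet_opposite_sign s npq hpq).
exists p, q; split=> // k; apply/idP/idP => [Zk|hk].
  rewrite leNgt; apply/negP => h; apply: nfull.
  exact: (cross_full Zp Zq Zs Zk npq hpq hps h).
apply/negPn/negP => nk.
have nZ t : Z t -> t != k by apply: contraTneq => ->.
have npk := raydet_line hF npq (nZ _ Zp) (nZ _ Zq) hpq.
have {}hk : 0 < D p k by rewrite lt0r npk.
have hqk : D q k < 0 by rewrite (raydet_opposite_neg k npq hpq).
have hqs : D q s < 0 by rewrite (raydet_opposite_neg s npq hpq).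
case: (ltrgtP (D s k) 0) => h.
- by case/negP: nk; apply: (sector_mem Zp Zs hk _ hps); rewrite raydetC oppr_gt0.
- by case/negP: nk; apply: (sector_mem Zs Zq h); rewrite raydetC oppr_gt0.
have := raydet_opposite_sign p (nZ s Zs) h.
by rewrite (raydetC v p k) (raydetC v p s); lia.
Qed.

End HalfPlane.

(** * Sign patterns with a margin *)

Lemma pairingE (K : comPzRingType) (w : 'cV[K]_2) (x : 'rV[K]_2) :
  pairing w x = x 0 0 * w 0 0 + x 0 1 * w 1 0.
Proof.
rewrite /pairing mxE !big_ord_recl big_ord0 addr0.
by congr (_ + x _ _ * w _ _); apply/val_inj.
Qed.

Section Margin.

Variables (R : realType) (n : nat) (v : 'I_n -> 'rV[int]_2).
Local Notation D := (raydet v).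
Local Notation vR i := (realify R (v i)).
Local Notation cyc := (ccw v).

Definition translate (b b' : 'I_n -> R) :=
  exists w : 'cV[R]_2, forall i, b' i = b i + pairing w (vR i).

Lemma translate_trans b1 b2 b3 :
  translate b1 b2 -> translate b2 b3 -> translate b1 b3.
Proof.
move=> [w1 h1] [w2 h2]; exists (w1 + w2) => i.
by rewrite h2 h1 !pairingE !mxE; ring.
Qed.

Lemma translate_between b b1 b2 :
  translate b b1 -> translate b b2 -> translate b1 b2.
Proof.
move=> [w1 h1] [w2 h2]; exists (w2 - w1) => i.
by rewrite h1 h2 !pairingE !mxE; ring.
Qed.

Lemma translate_opp b b' :
  translate (fun i => - b i) b' -> translate b (fun i => - b' i).
Proof.
by move=> [w h]; exists (- w) => i; rewrite h !pairingE !mxE; ring.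
Qed.

Lemma translate_raydet b e m (s t : R) :
  translate b (fun i => b i + (s * (D e i)%:~R + t * (D m i)%:~R)).
Proof.
exists (\col_k (if k == 0 then - s * (vR e) 0 1 - t * (vR m) 0 1
                else s * (vR e) 0 0 + t * (vR m) 0 0)) => i.
rewrite pairingE !mxE /= /raydet -!vdet_realify /vdet !mxE; ring.
Qed.

Lemma translate_cramer b b' p m x : translate b b' ->
  (D p m)%:~R * (b' x - b x) =
    (D x m)%:~R * (b' p - b p) + (D p x)%:~R * (b' m - b m).
Proof.
move=> [w h]; rewrite !h !pairingE /raydet -!vdet_realify /vdet !mxE; ring.
Qed.

(* No sign pattern that gives cohomology occurs with margin c: the patterns   *)
(* are "all nonnegative" (H^0), "all negative" (H^2) and at least four sign   *)
(* changes around the fan (H^1).                                              *)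
Definition unmixed (c : R) (b : 'I_n -> R) :=
  [/\ ~ (forall i, c <= b i), ~ (forall i, b i <= - c)
    & forall k x j y, cyc k x j -> cyc j y k ->
        c <= b k -> c <= b j -> b x <= - c -> b y <= - c -> False].

Definition acyclic (c : R) (b : 'I_n -> R) :=
  forall b', translate b b' -> unmixed c b'.

(** A combinatorial form of Serre duality: negation exchanges the H^0 and H^2 patterns and shifts
    the alternating pattern by one place. *)
Lemma acyclic_opp c b : acyclic c b -> acyclic c (fun i => - b i).
Proof.
move=> h b' /translate_opp /h [h0 h2 h1]; split=> [H|H|k x j y c1 c2 b1 b2 b3 b4].
- by apply: h2 => i; rewrite lerN2.
- by apply: h0 => i; rewrite lerNr.
have c3 := ccw_trans c1 c2; have c4 := ccw_trans c2 c1.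
by apply: (h1 _ _ _ _ c3 c4); lra.
Qed.

Lemma acyclic_translate c b b' : translate b b' -> acyclic c b -> acyclic c b'.
Proof. by move=> t h b2 t2; apply: h; apply: translate_trans t2. Qed.

End Margin.

Section FanMargin.

Variables (R : realType) (n : nat) (Sigma : {set {set 'I_n}}).
Variable v : 'I_n -> 'rV[int]_2.
Hypothesis hF : complete_stacky_fan R Sigma v.

Local Notation D := (raydet v).
Local Notation vR i := (realify R (v i)).
Local Notation cyc := (ccw v).

(** Take for [A] the negative rays on the arc from [k] to [j]. A cone joining one of them to a
    negative ray outside would have [k] or [j] strictly inside its sector. *)
Lemma H1_ccw_neq0 (r a : 'rV[int]_n) (w : 'cV[int]_2) k x j y :
  (forall i, a 0 i = r 0 i + pairing w (v i)) ->
  cyc k x j -> cyc j y k ->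
  0 <= a 0 k -> 0 <= a 0 j -> a 0 x < 0 -> a 0 y < 0 ->
  ~ cohomology_vanishes R Sigma v r 1.
Proof.
move=> ha ckxj cjyk ak aj ax ay.
apply: (H1_neq0 ha hF (A := [set m | cyc k m j && (a 0 m < 0)]%SET) (x := x) (y := y)) => //.
- by rewrite inE ckxj.
- by rewrite inE negb_and ccw_rot ccw_rot (ccw_asym (a := j)) // -ccw_rot.
move=> i m; rewrite !inE => /andP[ckij ai]; rewrite negb_and => + am.
rewrite am orbF => nckmj; apply/negP => hs.
have nkj : k != j.
  by apply: contraTneq ckij => ->; rewrite /ccw raydet_self (raydetC v j i); lia.
have [nmk njm] : m != k /\ j != m.
  by split; [apply: contraTneq am|apply: contraTneq aj] => ->; rewrite -?leNgt -?ltNge.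
have := ccw_total hF njm nmk nkj; rewrite [cyc j k m]ccw_rot (negbTE nckmj) orbF => cjmk.
have nim : i != m by apply: contraNneq nckmj => <-.
have c1 := ccw_trans ckij cjmk; have c2 := ccw_trans cjmk ckij.
case: (ltrgtP (D i m) 0) => h.
- have := @fan_not_ccw _ _ _ _ hF m i k.
  by rewrite finset.setUC hs c2 (raydetC v i m) oppr_gt0 h => /(_ isT isT).
- by have := @fan_not_ccw _ _ _ _ hF i m j hs h; rewrite c1.
by have := fan_raydet_neq0 hF hs nim; rewrite h eqxx.
Qed.

(** Rounding [w] down moves each value by at most [K]; the extra 1 in the margin makes negative
    values strictly negative. *)
Lemma H_trivial_acyclic : exists2 c : R, 0 <= c &
  forall r : 'rV[int]_n, H_trivial R Sigma v r ->
    acyclic v c (fun i => (r 0 i)%:~R).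
Proof.
pose K : R := \sum_i (`|(v i 0 0)%:~R| + `|(v i 0 1)%:~R|).
have K0 : 0 <= K by apply: sumr_ge0 => i _; rewrite addr_ge0.
have hK i : `|(v i 0 0)%:~R : R| + `|(v i 0 1)%:~R| <= K.
  rewrite /K (bigD1 i) //= lerDl; apply: sumr_ge0 => k _; exact: addr_ge0.
exists (K + 1); first by rewrite addr_ge0.
move=> r hr b [w hb].
pose w' : 'cV[int]_2 := \col_k Num.floor (w k 0).
pose a : 'rV[int]_n := \row_i (r 0 i + pairing w' (v i)).
have ha i : a 0 i = r 0 i + pairing w' (v i) by rewrite mxE.
have hd i : `|b i - (a 0 i)%:~R| <= K.
  apply: le_trans (hK i).
  have -> : b i - (a 0 i)%:~R = (v i 0 0)%:~R * (w 0 0 - (w' 0 0)%:~R)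
      + (v i 0 1)%:~R * (w 1 0 - (w' 1 0)%:~R).
    by rewrite hb ha !pairingE !mxE !(rmorphD, rmorphM) /=; ring.
  apply: le_trans (ler_normD _ _) _; rewrite !normrM !mxE.
  have hw k : `|w k 0 - (Num.floor (w k 0))%:~R| <= 1.
    have /andP[h1 h2] := floor_itv (w k 0); rewrite rmorphD /= in h2.
    by rewrite ler_norml; lra.
  by apply: lerD; rewrite ler_piMr.
have apos i : K + 1 <= b i -> 0 <= a 0 i.
  by move=> h; rewrite -(ler0z R); have := hd i; rewrite ler_norml; lra.
have aneg i : b i <= - (K + 1) -> a 0 i < 0.
  by move=> h; rewrite -(ltrz0 R); have := hd i; rewrite ler_norml; lra.
split=> [H|H|k x j y c1 c2 h1 h2 h3 h4].
- by apply: (H0_neq0 ha hF _ (hr 0%N)) => i; apply: apos.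
- by apply: (H2_neq0 ha hF _ (hr 2%N)) => i; apply: aneg.
by apply: (H1_ccw_neq0 ha c1 c2 _ _ _ _ (hr 1%N)); auto.
Qed.

End FanMargin.

(** * Separating small values from large ones *)

Section Gap.

Variables (R : realType) (n : nat) (F : R -> R).
Hypothesis F_ge : forall c, 0 <= c -> c <= F c.

Lemma iter_ge k c : 0 <= c -> c <= iter k F c.
Proof.
move=> c0; elim: k => //= k IH.
exact: le_trans IH (F_ge (le_trans c0 IH)).
Qed.

(** Each failure of a scale [c'] puts a new index below the next scale [F c'], which can happen at
    most [n] times. *)
Lemma gap_ex (b : 'I_n -> R) (c : R) : 0 <= c ->
  exists c', [/\ c <= c', c' <= iter n F c
    & forall i, c' < `|b i| -> F c' < `|b i|].
Proof.
pose S x := [set i | `|b i| <= x]%SET.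
suff H k d : (n <= k + #|S d|)%N -> 0 <= d ->
    exists c', [/\ d <= c', c' <= iter k F d
      & forall i, c' < `|b i| -> F c' < `|b i|].
  by apply: H; rewrite leq_addr.
elim: k d => [|k IH] {}c hk c0.
  exists c; split=> // i hi.
  have : i \in S c.
    have /eqP -> : S c == [set: 'I_n]; last by rewrite inE.
    by rewrite eqEcard finset.subsetT cardsT card_ord.
  by rewrite inE leNgt hi.
case: (pselect (forall i, c < `|b i| -> F c < `|b i|)) => [h|].
  by exists c; split=> //; apply: iter_ge.
move/existsNP => [i /not_implyP[hi /negP]]; rewrite -leNgt => hi'.
have [||c' [h1 h2 h3]] := IH (F c).
- apply: leq_trans hk _; rewrite addSnnS leq_add2l; apply: proper_card.
  apply/properP; split.
    apply/fintype.subsetP => j; rewrite !inE => hj.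
    by apply: le_trans hj (F_ge c0).
  by exists i; rewrite !inE // -ltNge.
- exact: le_trans (F_ge c0).
exists c'; split=> //; first by apply: le_trans h1; apply: F_ge.
by rewrite iterSr.
Qed.

End Gap.

(** * Prescribing the signs of small values *)

Section HalfPlaneMargin.

Variables (R : realType) (n : nat) (Sigma : {set {set 'I_n}}).
Variable v : 'I_n -> 'rV[int]_2.
Hypothesis hF : complete_stacky_fan R Sigma v.

Local Notation D := (raydet v).
Local Notation cyc := (ccw v).

Variable K : int.
Hypothesis D_le : forall i j, `|D i j| <= K.
Variable c0 : R.
Hypothesis c0_ge0 : 0 <= c0.

(* The displacements s D(e, -) + t D(m, -) used to prescribe signs have       *)
(* |s| + |t| <= K + 2; scaled by c + c0 they lift values of size at most c    *)
(* over the margin c0, and values beyond step c keep their sign and margin.   *)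
Definition stretch : int := K * K + 2 * K.
Definition step (c : R) : R := (stretch + 1)%:~R * (c + c0).

Lemma bound_ge0 (i : 'I_n) : 0 <= K.
Proof. exact: le_trans (normr_ge0 _) (D_le i i). Qed.

Lemma step_ge (i : 'I_n) c : 0 <= c -> c <= step c.
Proof.
move=> c_ge0; rewrite /step -[leLHS]mul1r; apply: ler_pM => //; last by rewrite lerDl.
by have := bound_ge0 i; rewrite ler1z /stretch; clear; nia.
Qed.

Lemma perturb (b : 'I_n -> R) c e m (s t : int) : 0 <= c ->
  (forall x, `|s * D e x + t * D m x| <= stretch) ->
  exists b', [/\ translate v b b',
    forall z, `|b z| <= c -> 1 <= s * D e z + t * D m z -> c0 <= b' z,
    forall z, `|b z| <= c -> s * D e z + t * D m z <= - 1 -> b' z <= - c0,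
    forall z, step c < b z -> c0 <= b' z
  & forall z, b z < - step c -> b' z <= - c0].
Proof.
move=> cge hf; set l := c + c0; have l0 : 0 <= l by exact: addr_ge0.
pose f x : int := s * D e x + t * D m x.
exists (fun x => b x + (l * s%:~R * (D e x)%:~R + l * t%:~R * (D m x)%:~R)).
have E x : b x + (l * s%:~R * (D e x)%:~R + l * t%:~R * (D m x)%:~R)
   = b x + l * (f x)%:~R.
  by rewrite /f; move: (D e x) (D m x) => X Y; rewrite intrD !intrM; ring.
have hb x : - (stretch%:~R * l) <= l * (f x)%:~R <= stretch%:~R * l.
  have := hf x; rewrite -/(f x) ler_norml => /andP[h1 h2].
  rewrite -mulNr [l * _]mulrC !ler_wpM2r // -?rmorphN ler_int; lia.
have hs : step c = stretch%:~R * l + l by rewrite /step intrD mulrDl mul1r.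
split.
- exact: translate_raydet.
- move=> z hz h1; rewrite E.
  have : l <= l * (f z)%:~R by rewrite ler_peMr // ler1z.
  by move: hz; rewrite ler_norml /l; lra.
- move=> z hz h1; rewrite E.
  have : l * (f z)%:~R <= l * (-1)%:~R by rewrite ler_wpM2l // ler_int.
  by move: hz; rewrite rmorphN /= ler_norml /l; lra.
- by move=> z; rewrite E hs; have /andP[] := hb z; rewrite /l; lra.
- by move=> z; rewrite E hs; have /andP[] := hb z; rewrite /l; lra.
Qed.

Lemma stretch_le (s t : int) e m : `|s| + `|t| <= K + 2 ->
  forall x, `|s * D e x + t * D m x| <= stretch.
Proof.
move=> hst x; apply: le_trans (ler_normD _ _) _; rewrite !normrM.
have := D_le e x; have := D_le m x; have := bound_ge0 x; rewrite /stretch.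
move: hst; move: `|s| `|t| `|D e x| `|D m x| (normr_ge0 s) (normr_ge0 t)
  (normr_ge0 (D e x)) (normr_ge0 (D m x)) => S T X Y; nia.
Qed.

Section Gapped.

Variables (b : 'I_n -> R) (c : R).
Hypothesis (hb : acyclic v c0 b) (c_ge0 : 0 <= c).

(** All other rays lie on the arc from [j] back to [i]. Whichever of [k], [l] comes first there,
    giving [i] and [j] suitable opposite signs makes the four signs alternate. *)
Lemma gap_same_sign i j k l : [set i; j] \in Sigma -> 0 < D i j ->
  `|b i| <= c -> `|b j| <= c -> step c < b k -> b l < - step c -> False.
Proof.
move=> hs hij bi bj bk bl.
have K0 := bound_ge0 i.
have st0 := step_ge i c_ge0.
have small_neq x y : `|b x| <= c -> step c < b y \/ b y < - step c -> x != y.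
  by move=> h1 h2; apply/eqP => E; subst; move: h1 h2; rewrite ler_norml; lra.
have nij := raydet_gt0_neq hij.
have cijx x : x != i -> x != j -> cyc i j x.
  move=> ni; rewrite eq_sym => nj; have := ccw_total hF nij nj ni.
  by rewrite (negbTE (fan_not_ccw hF x hs hij)) orbF.
have ck : cyc i j k by apply: cijx; rewrite eq_sym; apply: small_neq; auto.
have cl : cyc i j l by apply: cijx; rewrite eq_sym; apply: small_neq; auto.
have nkl : k != l.
  apply/eqP => E; move: bk bl; rewrite E; have := le_trans c_ge0 st0; lra.
have nlj : l != j by rewrite eq_sym; apply: small_neq; auto.
have njk : j != k by apply: small_neq; auto.
have [Dii Djj] := (raydet_self v i, raydet_self v j).
have Dji : D j i = - D i j by exact: raydetC.
case/orP: (ccw_total hF njk nkl nlj) => h.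
  have [|b' [tb p1 p2 p3 p4]] := @perturb b c i j (-1) (-1) c_ge0.
    by apply: stretch_le; clear -K0; lia.
  have [_ _ H] := hb tb; have cli : cyc l i j by rewrite ccw_rot.
  apply: (H k l i j (ccw_trans h cli) ck); auto.
  - by apply: p1 => //; rewrite ?Dii ?Djj ?Dji; clear -hij; lia.
  - by apply: p2 => //; rewrite ?Dii ?Djj ?Dji; clear -hij; lia.
have [|b' [tb p1 p2 p3 p4]] := @perturb b c i j 1 1 c_ge0.
  by apply: stretch_le; clear -K0; lia.
have [_ _ H] := hb tb; have ckij : cyc k i j by rewrite ccw_rot.
apply: (H k i j l ckij h); auto.
- by apply: p1 => //; rewrite ?Dii ?Djj ?Dji; clear -hij; lia.
- by apply: p2 => //; rewrite ?Dii ?Djj ?Dji; clear -hij; lia.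
Qed.

Hypothesis gap : forall i, c < `|b i| -> step c < b i.

Lemma small_not_positive e1 e2 : `|b e1| <= c -> `|b e2| <= c ->
  ~ (forall z, `|b z| <= c -> 1 <= D e1 z - D e2 z).
Proof.
move=> _ _ h; have K0 := bound_ge0 e1.
have [|b' [tb p1 p2 p3 p4]] := @perturb b c e1 e2 1 (-1) c_ge0.
  by apply: stretch_le; clear -K0; lia.
have [H _ _] := hb tb; apply: H => i; case: (lerP `|b i| c) => hi.
  by apply: p1 => //; have := h i hi; clear; lia.
by apply: p3; apply: gap.
Qed.

(** Some small [z] lies outside the closed sector, by [small_not_positive]. If the value at [k] were
    large, hence positive, making [z1], [z2] negative and [z] positive would give the alternating
    pattern. *)
Lemma small_sector z1 z2 k : `|b z1| <= c -> `|b z2| <= c ->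
  0 < D z1 k -> 0 < D k z2 -> 0 < D z1 z2 -> `|b k| <= c.
Proof.
move=> s1 s2 h1 h2 h12; rewrite leNgt; apply/negP => /gap bk.
have K0 := bound_ge0 z1.
have n12 := raydet_gt0_neq h12.
have [z sz hz] : exists2 z, `|b z| <= c & D z1 z < 0 \/ D z2 z > 0.
  case: (pselect (exists2 z, `|b z| <= c & D z1 z < 0 \/ D z2 z > 0)) => // hn.
  case: (small_not_positive s1 s2) => z sz.
  have g1 : 0 <= D z1 z by rewrite leNgt; apply/negP => h; apply: hn; exists z; auto.
  have g2 : D z2 z <= 0 by rewrite leNgt; apply/negP => h; apply: hn; exists z; auto.
  case: (eqVneq (D z1 z) 0) => e1; last by move: e1 g1 g2; clear; lia.
  case: (eqVneq (D z2 z) 0) => e2; last by move: e2 g1 g2; clear; lia.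
  case: (eqVneq z1 z) => [E|nz1].
    by move: h12; rewrite raydetC E e2.
  case: (eqVneq z2 z) => [E|nz2]; first by move: h12; rewrite E e1.
  have : D z z1 = 0 by rewrite raydetC e1 oppr0.
  move/(raydet_line hF) => /(_ z2); rewrite eq_sym nz1 eq_sym nz2 n12.
  by rewrite (raydetC v z2 z) e2 => /(_ isT isT isT); rewrite oppr0 eqxx.
have nz1 : z != z1.
  apply/eqP => E; move: hz; rewrite E raydet_self (raydetC v z1 z2); clear -h12; lia.
have nz2 : z2 != z.
  apply/eqP => E; move: hz; rewrite -E raydet_self; clear -h12; lia.
have c1k2 : cyc z1 k z2 by rewrite ccw_pos // h1.
have c2z1 : cyc z2 z z1.
  have := ccw_total hF n12 nz2 nz1; rewrite ccw_rot => /orP[] //.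
  by rewrite ccw_pos // (raydetC v z2 z); clear -hz; lia.
have ck := ccw_trans c1k2 c2z1; have cz := ccw_trans c2z1 c1k2.
have [D11 D22] := (raydet_self v z1, raydet_self v z2).
have D21 : D z2 z1 = - D z1 z2 by exact: raydetC.
have := D_le z1 z; have := D_le z2 z => u2 u1.
case: hz => hz.
  (* The weight [K + 1] lets the term of known sign at [z] outweigh the other one, which is at most
     [K] in size. *)
  have [|b' [tb p1 p2 p3 p4]] := @perturb b c z1 z2 (- (K + 1)) 1 c_ge0.
    by apply: stretch_le; clear -K0; lia.
  have [_ _ H] := hb tb; apply: (H _ _ _ _ ck cz); auto.
  - by apply: p1 => //; clear -hz u1 u2 K0; nia.
  - by apply: p2 => //; rewrite D22; clear -h12 K0; nia.
  - by apply: p2 => //; rewrite D11 D21; clear -h12 K0; nia.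
have [|b' [tb p1 p2 p3 p4]] := @perturb b c z1 z2 (- 1) (K + 1) c_ge0.
  by apply: stretch_le; clear -K0; lia.
have [_ _ H] := hb tb; apply: (H _ _ _ _ ck cz); auto.
- by apply: p1 => //; clear -hz u1 u2 K0; nia.
- by apply: p2 => //; rewrite D22; clear -h12 K0; nia.
- by apply: p2 => //; rewrite D11 D21; clear -h12 K0; nia.
Qed.

Lemma small_half_plane i j k0 : `|b i| <= c -> `|b j| <= c -> 0 < D i j ->
  c < `|b k0| ->
  exists p q, [/\ p != q, D p q = 0 & forall k, (`|b k| <= c) = (0 <= D p k)].
Proof.
move=> si sj hij hk0.
apply: (@half_plane_ex _ _ _ _ hF (fun k => `|b k| <= c) _ i j k0) => //.
- exact: small_sector.
- by rewrite -ltNge.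
- exact: small_not_positive.
Qed.

End Gapped.

(** The half plane is exactly the set of values at most [c'], for a gap scale [c'] that depends on
    [b]; only the uniform bounds on both sides of [c'] are kept. *)
Lemma half_plane_or_bounded b c i j : acyclic v c0 b -> 0 <= c ->
  [set i; j] \in Sigma -> 0 < D i j -> `|b i| <= c -> `|b j| <= c ->
  (forall k, `|b k| <= iter n step c) \/
  exists p q, [/\ p != q, D p q = 0, 
    forall k, 0 <= D p k -> `|b k| <= iter n step c
  & forall k, `|b k| <= c -> 0 <= D p k].
Proof.
move=> hb c_ge0 hs hij bi bj.
have [c' [h1 h2 h3]] := gap_ex (step_ge i) b c_ge0.
case: (pselect (forall k, `|b k| <= c')) => [h|].
  by left=> k; apply: le_trans (h k) h2.
move/existsNP => [k0 /negP]; rewrite -ltNge => hk0; right.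
have c'_ge0 : 0 <= c' by apply: le_trans h1.
have bi' := le_trans bi h1; have bj' := le_trans bj h1.
wlog pos : b hb bi bj h3 hk0 bi' bj' / step c' < b k0.
  move=> H; have := h3 _ hk0; rewrite lter_normr => /orP[h|h]; first exact: H.
  have [||||||||p [q [npq hpq q1 q2]]] := H (fun x => - b x); rewrite ?normrN //.
  - exact: acyclic_opp.
  - by move=> k; rewrite normrN; apply: h3.
  by exists p, q; split=> // k; [have := q1 k|have := q2 k]; rewrite normrN.
have [p [q [npq hpq hp]]] : exists p q,
    [/\ p != q, D p q = 0 & forall k, (`|b k| <= c') = (0 <= D p k)].
  apply: (small_half_plane hb c'_ge0 _ bi' bj' hij hk0) => k /h3.
  rewrite lter_normr => /orP[] // bk; exfalso.
  apply: (@gap_same_sign b c' hb c'_ge0 i j k0 k) => //; lra.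
exists p, q; split=> // k; first by rewrite -hp => h; apply: le_trans h2.
by move=> h; rewrite -hp; apply: le_trans h1.
Qed.

End HalfPlaneMargin.

(** * Two opposite half planes *)

Section TwoHalfPlanes.

Variables (R : realType) (n : nat) (Sigma : {set {set 'I_n}}).
Variable v : 'I_n -> 'rV[int]_2.
Hypothesis hF : complete_stacky_fan R Sigma v.

Local Notation D := (raydet v).

Variable K : int.
Hypothesis D_le : forall i j, `|D i j| <= K.

Lemma translate_zero (b : 'I_n -> R) i j : 0 < D i j ->
  exists b', [/\ translate v b b', b' i = 0 & b' j = 0].
Proof.
move=> hij; have hR : (D i j)%:~R != 0 :> R by rewrite intr_eq0 gt_eqF.
exists (fun x => b x + (b i / (D i j)%:~R * (D j x)%:~R
  + - b j / (D i j)%:~R * (D i x)%:~R)); split.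
- exact: translate_raydet.
- by rewrite raydet_self (raydetC v i j) rmorphN /= mulr0 mulrN divfK // addr0 subrr.
- by rewrite raydet_self mulr0 add0r divfK // subrr.
Qed.

Lemma raydet_leR i j : `|(D i j)%:~R| <= K%:~R :> R.
Proof. by rewrite -intr_norm ler_int. Qed.

(** A functional is controlled by its values at two independent rays, by Cramer's rule with an
    integer denominator. *)
Lemma translate_close (b b' : 'I_n -> R) c p m : translate v b b' ->
  0 <= c -> D p m != 0 ->
  `|b' p - b p| <= c -> `|b' m - b m| <= c ->
  forall x, `|b' x - b x| <= 2 * K%:~R * c.
Proof.
move=> tb c0 hpm hp hm x.
have h1 : 1 <= `|(D p m)%:~R| :> R by rewrite -intr_norm ler1z -gtz0_ge1 normr_gt0.
apply: (@le_trans _ _ (`|(D p m)%:~R| * `|b' x - b x|)); first by rewrite ler_peMl.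
rewrite -normrM (translate_cramer p m x tb); apply: le_trans (ler_normD _ _) _.
rewrite !normrM -mulrA mulr2n mulrDl mul1r.
by apply: lerD; apply: ler_pM => //; exact: raydet_leR.
Qed.

(* In terms of the lines b_i = 0 in N^*_R: either all of them pass within     *)
(* bounded distance of one point, or those of each of two opposite closed     *)
(* half planes do.                                                            *)
Lemma acyclic_dichotomy (c0 : R) : 0 <= c0 ->
  exists2 C : R, 0 <= C & forall b, acyclic v c0 b ->
    (exists2 b', translate v b b' & forall i, `|b' i| <= C) \/
    exists p q b1 b2, [/\ p != q, D p q = 0, translate v b b1 /\ translate v b b2,
      forall i, 0 <= D p i -> `|b1 i| <= C & forall i, 0 <= D q i -> `|b2 i| <= C].
Proof.
move=> c0_ge0.
have [i0] := fan_inhabited hF.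
have K0 := bound_ge0 D_le i0.
have KR0 : 0 <= K%:~R :> R by rewrite ler0z.
have st := @step_ge _ _ _ _ D_le _ c0_ge0 i0.
pose B x := iter n (step K c0) x.
have B_ge x : 0 <= x -> x <= B x by exact: iter_ge.
pose C1 := B 0; have C1_ge0 : 0 <= C1 by apply: B_ge.
pose C2 := C1 + 2 * K%:~R * (2 * C1).
have C12 : C1 <= C2 by rewrite lerDl !mulr_ge0.
have C2_ge0 : 0 <= C2 by apply: le_trans C12.
pose C3 := B C2; have C23 : C2 <= C3 by apply: B_ge.
exists C3; first exact: le_trans C23.
move=> b hb.
have C13 : C1 <= C3 by apply: le_trans C23.
have HP := half_plane_or_bounded hF D_le c0_ge0.
have [j0 [h00 s00]] := exists_next hF i0.
have [b1 [t1 b1i b1j]] := translate_zero b h00.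
have hb1 := acyclic_translate t1 hb.
have := HP b1 0 i0 j0 hb1 (lexx 0) s00 h00; rewrite b1i b1j normr0.
move=> /(_ (lexx 0) (lexx 0)) [h|[p [q [npq hpq H1 H1']]]].
  by left; exists b1 => // i; apply: le_trans C13.
(* The neighbour [k] of [q] lies beyond the first half plane, so the second one cannot coincide with
   it. *)
have [k [hqk sqk]] := exists_next hF q.
have hpk : D p k < 0 by rewrite -(raydet_opposite_sign hF k npq hpq).
have [b2 [t2 b2q b2k]] := translate_zero b hqk.
have hb2 := acyclic_translate t2 hb.
have := HP b2 0 q k hb2 (lexx 0) sqk hqk; rewrite b2q b2k normr0.
move=> /(_ (lexx 0) (lexx 0)) [h|[p2 [q2 [npq2 hpq2 H2 H2']]]].
  by left; exists b2 => // i; apply: le_trans C13.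
have hp2k : 0 <= D p2 k by apply: H2'; rewrite b2k normr0.
have hline x : 0 <= D x k -> D x p = 0 -> x = q.
  move=> hx0 hxp; apply/eqP/negPn/negP => nxq.
  case: (eqVneq x p) => [E|nxp]; first by move: hx0; rewrite E leNgt hpk.
  have := raydet_line hF npq (k := x); rewrite eq_sym nxp eq_sym nxq hpq.
  by rewrite (raydetC v x p) hxp oppr0 eqxx => /(_ isT isT erefl).
case: (eqVneq (D p2 p) 0) => [hp2p|np2p].
  have E := hline p2 hp2k hp2p; right; exists p, q, b1, b2; split=> //.
    by move=> i hi; apply: le_trans (H1 i hi) C13.
  by move=> i hi; apply: le_trans C13; apply: H2; rewrite E.
left; exists b1 => //.
(* When the boundary lines differ, [b1] and [b2] are both small at [q] and at some [z] off the line
   of [p] and [q]; hence they are close everywhere, and [b1 k] is at most [C2]. *)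
have [z [hpz hz2]] : exists z, 0 < D p z /\ 0 <= D p2 z.
  case: (ltrgtP (D p p2) 0) => h.
  - exists q2; rewrite hpq2 lexx; split=> //.
    have := raydet_opposite_sign hF p npq2 hpq2.
    rewrite (raydetC v p q2) (raydetC v p p2) !oppr_gt0 oppr_lt0.
    have [a [c [a0 c0' /(_ p)]]] := raydet_opposite hF npq2 hpq2.
    by rewrite (raydetC v p q2) (raydetC v p p2); move: h a0 c0'; clear; nia.
  - by exists p2; rewrite raydet_self.
  - by move: np2p; rewrite raydetC h oppr0 eqxx.
have t12 := translate_between t1 t2.
have nqz : D q z != 0.
  have [a [c [a0 c0' /(_ z)]]] := raydet_opposite hF npq hpq.
  by move: hpz a0 c0'; clear; nia.
have close y : `|b1 y| <= C1 -> `|b2 y| <= C1 -> `|b2 y - b1 y| <= 2 * C1.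
  by move=> h1 h2; apply: le_trans (ler_normB _ _) _; rewrite mulr2n mulrDl mul1r lerD.
have hk2 : `|b1 k| <= C2.
  have : `|b2 k - b1 k| <= 2 * K%:~R * (2 * C1).
    apply: (translate_close t12 _ nqz); first by rewrite mulr_ge0.
      by apply: close; [apply: H1; rewrite hpq|rewrite b2q normr0].
    by apply: close; [apply: H1; rewrite ltW|apply: H2].
  rewrite b2k sub0r normrN => h; apply: le_trans h _.
  by rewrite lerDr.
(* At scale [C2] a half plane would contain [p], [q] and [k], so it would be the one opposite to the
   first. But [i0] and [j0], where [b1] vanishes, would lie in both, hence on one line. *)
have := HP b1 C2 i0 j0 hb1 C2_ge0 s00 h00; rewrite b1i b1j normr0.
move=> /(_ C2_ge0 C2_ge0) [//|[p3 [q3 [npq3 hpq3 _ H3]]]].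
exfalso.
have p3p : 0 <= D p3 p.
  by apply: H3; apply: le_trans (H1 p _) C12; rewrite raydet_self.
have p3q : 0 <= D p3 q by apply: H3; apply: le_trans (H1 q _) C12; rewrite hpq.
have p3p0 : D p3 p = 0.
  have [a [c [a0 c0' /(_ p3)]]] := raydet_opposite hF npq hpq.
  rewrite (raydetC v p3 p) (raydetC v p3 q).
  by move: p3p p3q a0 c0'; clear; nia.
have E := hline p3 (H3 k hk2) p3p0.
have q0 x : b1 x = 0 -> D q x = 0.
  move=> bx; have h1 : 0 <= D p x by apply: H1'; rewrite bx normr0.
  have h2 : 0 <= D q x by rewrite -E; apply: H3; rewrite bx normr0.
  have [a [c [a0 c0' /(_ x)]]] := raydet_opposite hF npq hpq.
  by move: h1 h2 a0 c0'; clear; nia.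
have := raydet_plucker v i0 j0 q k; rewrite (raydetC v q i0) (raydetC v q j0).
rewrite (q0 i0 b1i) (q0 j0 b1j) oppr0 mul0r mulr0 addr0 subr0 => /eqP.
by rewrite mulf_eq0 !gt_eqF.
Qed.

(** Up to a bounded error due to its value at [p], the functional [b2 - b1] is [t] times [D p]. On
    the side of [q], [b2] is small, so [b1] is close to [- t * D p]; on the other side [b1] itself
    is small. *)
Lemma tube_shape (C : R) b1 b2 p q : 0 <= C -> p != q -> D p q = 0 ->
  translate v b1 b2 ->
  (forall i, 0 <= D p i -> `|b1 i| <= C) ->
  (forall i, 0 <= D q i -> `|b2 i| <= C) ->
  exists t, forall i,
    `|b1 i - t * (Num.max 0 (- D p i))%:~R| <= C + K%:~R * (2 * C).
Proof.
move=> C0 npq hpq tb h1 h2; have K0 := bound_ge0 D_le p.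
have KR0 : 0 <= K%:~R :> R by rewrite ler0z.
have [m hm] := raydet_pos_ex hF p.
have hR : (D p m)%:~R != 0 :> R by rewrite intr_eq0 gt_eqF.
exists ((b2 m - b1 m) / (D p m)%:~R) => x.
case: (lerP 0 (D p x)) => hx.
  have -> : Num.max 0 (- D p x) = 0 by apply: max_l; rewrite oppr_le0.
  by rewrite mulr0 subr0; apply: le_trans (h1 x hx) _; rewrite lerDl !mulr_ge0.
have -> : Num.max 0 (- D p x) = - D p x by apply: max_r; rewrite oppr_ge0 ltW.
have hqx : 0 < D q x by rewrite (raydet_opposite_sign hF x npq hpq).
have cr := translate_cramer p m x tb.
have -> : b1 x - (b2 m - b1 m) / (D p m)%:~R * (- D p x)%:~R =
    b2 x - (D x m)%:~R * (b2 p - b1 p) / (D p m)%:~R.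
  have e : b2 x = b1 x + ((D x m)%:~R * (b2 p - b1 p)
      + (D p x)%:~R * (b2 m - b1 m)) / (D p m)%:~R.
    by rewrite -cr mulrAC divff // mul1r addrC subrK.
  rewrite e rmorphN /=; move: (D p x) (D p m) (D x m) => X Y T; ring.
apply: le_trans (ler_normB _ _) _; apply: lerD; first by apply: h2; rewrite ltW.
rewrite !normrM -mulrA; apply: ler_pM => //; first exact: mulr_ge0.
  exact: raydet_leR.
rewrite normfV ler_pdivrMr ?normr_gt0 //.
apply: (@le_trans _ _ (2 * C)).
  apply: le_trans (ler_normB _ _) _; rewrite mulr2n mulrDl mul1r lerD //.
    by apply: h2; rewrite raydetC hpq oppr0.
  by apply: h1; rewrite raydet_self.
rewrite ler_peMr ?mulr_ge0 // -intr_norm ler1z -gtz0_ge1 normr_gt0 gt_eqF //.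
Qed.

End TwoHalfPlanes.

(** * Distances in the Picard group *)

Section PicardGroup.

Variables (R : realType) (n : nat) (Sigma : {set {set 'I_n}}).
Variable v : 'I_n -> 'rV[int]_2.
Hypothesis hF : complete_stacky_fan R Sigma v.
Variables (V : vectType R) (cl : {linear 'rV[R]_n -> V}).
Hypothesis hcl : is_PicR v cl.
Variable ip : {dot V for idfun}.

Local Notation D := (raydet v).

Lemma enorm_class_le : exists2 S : R, 0 <= S &
  forall (x : 'rV[R]_n) c, 0 <= c -> (forall i, `|x 0 i| <= c) ->
    enorm ip (cl x) <= S * c.
Proof.
pose e (i : 'I_n) := cl (delta_mx 0 i).
pose T : R := \sum_i \sum_j `|ip (e i) (e j)|.
exists (Num.sqrt T) => [|x c c0 hx]; first exact: sqrtr_ge0.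
have T0 : 0 <= T by do 2!apply: sumr_ge0 => ? _.
rewrite /enorm -[X in _ * X](ger0_norm c0) -sqrtr_sqr -sqrtrM //.
apply: ler_wsqrtr.
have -> : cl x = \sum_i x 0 i *: e i.
  rewrite {1}(row_sum_delta x) linear_sum; apply: eq_bigr => i _.
  by rewrite linearZ.
rewrite linear_sumlz mulr_suml; apply: ler_sum => i _ /=.
rewrite linear_sumr mulr_suml; apply: ler_sum => j _ /=.
rewrite linearZl_LR linearZr_LR /= mulrA.
apply: le_trans (ler_norm _) _; rewrite normrM mulrC ler_wpM2l //.
by rewrite normrM expr2 ler_pM.
Qed.

Lemma class_translate (b b' : 'I_n -> R) : translate v b b' ->
  cl (\row_i b i) = cl (\row_i b' i).
Proof.
move=> [w hw]; apply/eqP; rewrite eq_sym -subr_eq0 -linearB; apply/eqP.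
apply/(PicR_ker hcl); exists w; apply/rowP => i.
by rewrite !mxE hw addrC addKr.
Qed.

(** A functional vanishing at [p] and at a ray strictly on its positive side is zero, but this
    family is positive on the negative side. *)
Lemma half_class_neq0 p : cl (\row_i (Num.max 0 (- D p i))%:~R) != 0.
Proof.
apply/eqP => /(PicR_ker hcl)[w /rowP hw].
have [i hi] := raydet_pos_ex hF p; have [j hj] := raydet_neg_ex hF p.
have /(translate_cramer p i j) :
    translate v (fun=> 0) (fun i => pairing w (realify R (v i))).
  by exists w => k; rewrite add0r.
have := hw p; have := hw i; have := hw j; rewrite !mxE => <- <- <-.
rewrite raydet_self oppr0 maxxx (max_l (_ : - D p i <= 0)) ?oppr_le0 ?ltW //.
rewrite (max_r (_ : 0 <= - D p j)) ?oppr_ge0 ?ltW // !addr0 !mulr0z !mulr0 addr0.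
by move/eqP; rewrite mulf_eq0 !intr_eq0 oppr_eq0 gt_eqF // lt_eqF.
Qed.

Lemma enorm_ge0 x : 0 <= enorm ip x.
Proof. exact: sqrtr_ge0. Qed.

Lemma edist_to_le (L : {vspace V}) x y : y \in L ->
  edist_to ip L x <= enorm ip (x - y).
Proof.
move=> yL; apply: ge_inf; last by exists y.
by exists 0 => _ [z _ ->]; exact: enorm_ge0.
Qed.

Lemma opposite_collinear p q : p != q -> D p q = 0 -> collinear R (v p) (v q).
Proof.
move=> npq hpq; have [a [b [a0 b0 h]]] := fan_opposite hF npq hpq.
exists <[realify R (v p)]>%VS; split; last 2 first.
- exact: memv_line.
- apply/vlineP; exists (- a%:~R / b%:~R).
  have bR : b%:~R != 0 :> R by rewrite intr_eq0 gt_eqF.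
  apply: (scalerI bR); rewrite scalerA mulrC divfK //.
  apply/rowP => k; have /rowP/(_ k) := h; rewrite !mxE => /(congr1 (fun z : int => z%:~R : R)).
  rewrite !rmorphD !rmorphM /= => hh; apply/eqP.
  by rewrite mulNr -subr_eq0 opprK addrC hh.
rewrite dim_vline; apply/eqP; rewrite eqb1; apply: contra (fan_generator_neq0 hF p).
by move/eqP => h0; apply/eqP; apply: (@realify_inj R); rewrite h0; apply/rowP => k; rewrite !mxE.
Qed.

End PicardGroup.

(** * The ball and the tubes *)

Theorem theorem4p9 (R : realType) (n : nat) (Sigma : {set {set 'I_n}})
    (v : 'I_n -> 'rV[int]_2) (hSigma : complete_stacky_fan R Sigma v)
    (V : vectType R) (cl : {linear 'rV[R]_n -> V}) (hcl : is_PicR v cl)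
    (ip : {dot V for idfun}) :
  exists (ell : 'I_#|collinear_pairs R v| -> {vspace V}) (R0 : R),
    [/\ forall i, \dim (ell i) = 1%N,
        0 < R0
      & forall (beta : 'I_#|collinear_pairs R v| -> R) (rho : R),
          (forall i, R0 <= beta i) -> R0 <= rho ->
          forall r : 'rV[int]_n,
            ~ (origin_ball ip rho `|`
                 \bigcup_i tube ip (ell i) (beta i))%classic
                (bundle_class cl r) ->
            ~ H_trivial R Sigma v r].
Proof.
have [c0 c0_ge0 hac] := H_trivial_acyclic hSigma.
pose K : int := \sum_i \sum_j `|raydet v i j|.
have hK i j : `|raydet v i j| <= K.
  rewrite /K (bigD1 i) //= (bigD1 j) //= -addrA lerDl addr_ge0 //.
    by apply: sumr_ge0.
  by apply: sumr_ge0 => k _; apply: sumr_ge0.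
have [C C0 hdich] := acyclic_dichotomy hSigma hK c0_ge0.
have [S S0 hS] := enorm_class_le cl ip.
have [i0] := fan_inhabited hSigma; have K0 := bound_ge0 hK i0.
pose C' := C + K%:~R * (2 * C).
have C'C : C <= C' by rewrite lerDl !mulr_ge0 // ler0z.
have C'0 : 0 <= C' by apply: le_trans C'C.
pose half (p : 'I_n) : 'rV[R]_n := \row_i (Num.max 0 (- raydet v p i))%:~R.
(* [S * C'] bounds the distance in both cases; adding 1 makes the radius positive. *)
exists (fun e => <[cl (half (enum_val e).1)]>%VS), (S * C' + 1); split.
- by move=> e; rewrite dim_vline (half_class_neq0 hSigma hcl).
- by rewrite ltr_wpDl // mulr_ge0.
move=> beta rho hbeta hrho r hout /hac /hdich.
have bcE b : translate v (fun i => (r 0 i)%:~R) b -> bundle_class cl r = cl (\row_i b i).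
  move=> t; rewrite -(class_translate hcl t) /bundle_class; congr (cl _).
  by apply/rowP => i; rewrite !mxE.
have R0_le : S * C' <= S * C' + 1 by rewrite lerDl.
case=> [[b tb hb]|[p [q [b1 [b2 [npq hpq [t1 t2] h1 h2]]]]]].
  apply: hout; left; rewrite /origin_ball /= (bcE b tb).
  apply: le_trans hrho; apply: le_trans R0_le; apply: hS => // i.
  by rewrite mxE; apply: le_trans (hb i) C'C.
apply: hout; right.
(* The line of a pair is built from its smaller index; exchanging [p] and [q] exchanges the two half
   planes. *)
wlog ltpq : p q b1 b2 npq hpq t1 t2 h1 h2 / (p < q)%N.
  move=> H; case: (ltngtP p q) => h; first exact: (H p q b1 b2).
    by apply: (H q p b2 b1); rewrite // 1?eq_sym // raydetC hpq oppr0.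
  by case/eqP: npq; apply: val_inj.
have pqA : (p, q) \in collinear_pairs R v.
  by rewrite inE /= ltpq /=; apply/asboolP; exact: (opposite_collinear hSigma npq hpq).
exists (enum_rank_in pqA (p, q)) => //=.
rewrite /tube /= enum_rankK_in //=.
have t12 := translate_between t1 t2.
have [t ht] := tube_shape hSigma hK C0 npq hpq t12 h1 h2.
apply: le_trans (hbeta _); apply: le_trans R0_le.
apply: le_trans (edist_to_le ip _ (_ : t *: cl (half p) \in _)) _.
  exact/memvZ/memv_line.
rewrite (bcE b1 t1) -linearZ -linearB; apply: hS => // i.
by rewrite !mxE; exact: ht.
Qed.
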